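(* Let $n\geq 5$ and let $H=\langle (12),(34)\rangle\cong\mathbb Z_2\times\mathbb Z_2\subseteq\mathbb S_n$. Let $\omega$ be a 2-cocycle on $\widehat H$ whose cohomology class is nontrivial, and let $J=\sum_{\alpha,\beta\in\widehat H}\omega(\alpha,\beta)e_\alpha\otimes e_\beta$. Then the Hopf algebra $(k\mathbb S_n)^J$ is simple.
   Context: $k$ is an algebraically closed field of characteristic zero. For a twist $J$ in a Hopf algebra $A$, $A^J$ is the Hopf algebra with the same algebra and counit, comultiplication $\Delta^J(h)=J^{-1}\Delta(h)J$ and antipode $S^J(h)=v^{-1}S(h)v$, $v=m(S\otimes\mathrm{id})(J)$. For an abelian subgroup $H$ of a finite group $G$, $\widehat H$ is its character group and $e_\chi=\frac{1}{|H|}\sum_{h\in H}\chi(h^{-1})h$; for a 2-cocycle $\omega$ on $\widehat H$, $J=\sum\omega(\alpha,\beta)e_\alpha\otimes e_\beta$ is a twist in $kG$. A Hopf subalgebra is normal if stable under the adjoint action ${}^hx=\sum h_1xS(h_2)$; a Hopf algebra is simple if it has no normal Hopf subalgebras other than $k$ and itself. *)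

(* Defs.v *)
From HB Require Import structures.
From mathcomp Require Import all_boot all_order all_algebra all_fingroup.
From Stdlib Require Import ClassicalEpsilon.
Set Implicit Arguments. Unset Strict Implicit. Unset Printing Implicit Defensive.
Import GRing.Theory.
Local Open Scope ring_scope.

Section GroupAlgebra.
Variables (gT : finGroupType) (k : fieldType).

(* kG: an element is its coefficient function g |-> coefficient of g *)
Definition galg := {ffun gT -> k}.
(* kG (x) kG = k[G x G] *)
Definition talg := {ffun gT * gT -> k}.

Definition gscale (c : k) (a : galg) : galg := [ffun g => (c * a g)%R].
Definition tscale (c : k) (t : talg) : talg := [ffun p => (c * t p)%R].

Definition gdelta (g : gT) : galg := [ffun x => ((x == g)%:R)%R].
Definition gone : galg := gdelta 1%g.
Definition gmul (a b : galg) : galg :=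
  [ffun g => (\sum_(x : gT) a x * b (x^-1 * g)%g)%R].

Definition tone : talg := [ffun p => ((p == (1%g, 1%g))%:R)%R].
Definition tmul (s t : talg) : talg :=
  [ffun p => (\sum_(q : gT * gT) s q * t ((q.1^-1 * p.1)%g, (q.2^-1 * p.2)%g))%R].
Definition tens (a b : galg) : talg := [ffun p => (a p.1 * b p.2)%R].

(* two-sided inverses (chosen classically; only used on invertible elements) *)
Definition ginv (a : galg) : galg :=
  epsilon (inhabits (0%R : galg)) (fun b => gmul a b = gone /\ gmul b a = gone).
Definition tinv (t : talg) : talg :=
  epsilon (inhabits (0%R : talg)) (fun s => tmul t s = tone /\ tmul s t = tone).

(* Hopf structure of kG: Delta g = g (x) g, S g = g^-1 *)
Definition gDelta (a : galg) : talg :=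
  [ffun p => if p.1 == p.2 then a p.1 else 0%R].
Definition gS (a : galg) : galg := [ffun g => a g^-1%g].

Definition DeltaJ (J : talg) (a : galg) : talg := tmul (tinv J) (tmul (gDelta a) J).
(* v = m (S (x) id) (J) *)
Definition twist_v (J : talg) : galg := \sum_(p : gT * gT) gscale (J p) (gdelta (p.1^-1 * p.2)%g).
Definition SJ (J : talg) (a : galg) : galg :=
  gmul (ginv (twist_v J)) (gmul (gS a) (twist_v J)).

Definition in_tensor (B : galg -> Prop) (t : talg) : Prop :=
  exists (m : nat) (x y : 'I_m -> galg),
    (forall i, B (x i) /\ B (y i)) /\ t = (\sum_(i < m) tens (x i) (y i))%R.

Definition is_hopf_subalg (J : talg) (B : galg -> Prop) : Prop :=
  [/\ (B 0%R /\ (forall a b, B a -> B b -> B (a + b)%R) /\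
       (forall c a, B a -> B (gscale c a))),
      B gone,
      (forall a b, B a -> B b -> B (gmul a b)),
      (forall a, B a -> in_tensor B (DeltaJ J a)) &
      (forall a, B a -> B (SJ J a))].

(* left adjoint action of (kG)^J : h . x = sum h_1 x S^J(h_2) *)
Definition adJ (J : talg) (h x : galg) : galg :=
  (\sum_(p : gT * gT)
      gscale (DeltaJ J h p) (gmul (gmul (gdelta p.1) x) (SJ J (gdelta p.2))))%R.

Definition is_normal_hopf_subalg (J : talg) (B : galg -> Prop) : Prop :=
  is_hopf_subalg J B /\ (forall h x, B x -> B (adJ J h x)).

Definition twisted_simple (J : talg) : Prop :=
  forall B, is_normal_hopf_subalg J B ->
    (forall x, B x <-> exists c, x = gscale c gone) \/ (forall x, B x).

(* characters of an abelian subgroup H: homomorphisms H -> k^x, represented as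
   functions on gT vanishing outside H; product = pointwise product *)
Definition is_hchar (H : {set gT}) (chi : galg) : Prop :=
  [/\ forall x, x \notin H -> chi x = 0%R,
      forall x, x \in H -> chi x != 0%R &
      forall x y, x \in H -> y \in H -> chi (x * y)%g = (chi x * chi y)%R].

Definition char_mul (a b : galg) : galg := [ffun g => (a g * b g)%R].

Definition e_chi (H : {set gT}) (chi : galg) : galg :=
  [ffun g => if g \in H then ((#|H|%:R)^-1 * chi g^-1%g)%R else 0%R].

Definition enumerates_chars (H : {set gT}) (s : seq galg) : Prop :=
  uniq s /\ forall chi, chi \in s <-> is_hchar H chi.

Definition is_2cocycle (H : {set gT}) (w : galg -> galg -> k) : Prop :=
  (forall a b, is_hchar H a -> is_hchar H b -> w a b != 0%R) /\
  (forall a b c, is_hchar H a -> is_hchar H b -> is_hchar H c ->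
     (w a b * w (char_mul a b) c = w b c * w a (char_mul b c))%R).

Definition is_2coboundary (H : {set gT}) (w : galg -> galg -> k) : Prop :=
  exists f : galg -> k,
    (forall a, is_hchar H a -> f a != 0%R) /\
    (forall a b, is_hchar H a -> is_hchar H b ->
       w a b = (f a * f b / f (char_mul a b))%R).

Definition twistJ (H : {set gT}) (s : seq galg) (w : galg -> galg -> k) : talg :=
  (\sum_(a <- s) \sum_(b <- s) tscale (w a b) (tens (e_chi H a) (e_chi H b)))%R.

End GroupAlgebra.

(* the transposition (i j) of {0,..,n-1} (identity if i or j is out of range) *)
Definition transp (n i j : nat) : 'S_n :=
  match insub i, insub j with
  | Some a, Some b => tperm a b
  | _, _ => 1%g
  end.

(* H = <(12),(34)> in S_n, with points numbered 0..n-1 *)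
Definition H1234 (n : nat) : {group 'S_n} :=
  <<[set transp n 0 1; transp n 2 3]>>%G.

(* Main.v *)
Require Import Defs.
From HB Require Import structures.
From mathcomp Require Import all_boot all_order all_algebra all_fingroup all_solvable.
From Stdlib Require Import Classical ClassicalEpsilon.
From mathcomp Require Import zify ring.
Set Implicit Arguments. Unset Strict Implicit. Unset Printing Implicit Defensive.
Import GRing.Theory.
Local Open Scope ring_scope.

(* Let B be a normal Hopf subalgebra of (kG)^J, G = S_n. Taking traces over B
   gives a two-sided integral Lam in B with eps(Lam) = 1. Normality of B makes Lam
   central in kG, so the twist disappears from Delta^J(Lam)(1 (x) Lam) = Lam (x) Lam;
   comparing coefficients, Lam is the average of a normal subgroup N, hence
   N = 1, A_n or S_n.
   If N = 1 then every x in B equals eps(x) 1. In the other cases B contains all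
   left and right legs of Delta^J(Lam). For N = S_n the left legs are the corners
   e_c g e_d, which span kG. For N = A_n the left and right legs are combinations
   of two corners with coefficients differing by the factor w(p,q)/w(q,p), which is
   not 1 since w is not a coboundary; so B contains a corner of every g. Choosing g
   with H and its g-conjugate meeting trivially, that corner generates, as a
   subcoalgebra, the span of HgH. So B contains group elements outside A_n, but
   a group element in B must fix Lam, i.e. lie in N. *)

(* A separate head constant, since [{ffun gT -> k}] already carries the pointwise
   product as its canonical ring structure. *)
Definition ga (k : fieldType) (gT : finGroupType) := galg gT k.

(** * The convolution algebra structure on kG *)

Section GroupAlgebraRing.
Variables (k : fieldType) (gT : finGroupType).
Notation A := (ga k gT).

HB.instance Definition _ := Vector.copy A {ffun gT -> k^o}.

Definition gd (g : gT) : A := gdelta k g.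
Definition ga_mul (a b : A) : A := gmul a b.

Lemma gdE g x : gd g x = (x == g)%:R.
Proof. by rewrite ffunE. Qed.

Lemma ga_mulE (a b : A) x : ga_mul a b x = \sum_y a y * b (y^-1 * x)%g.
Proof. by rewrite ffunE. Qed.

Lemma ga_addE (a b : A) x : (a + b) x = a x + b x.
Proof. by rewrite ffunE. Qed.

Lemma ga_scaleE c (a : A) x : (c *: a) x = c * a x.
Proof. by rewrite ffunE. Qed.

Fact ga_mulA : associative ga_mul.
Proof.
move=> a b c; apply/ffunP=> x; rewrite !ga_mulE.
under eq_bigr do rewrite ga_mulE mulr_sumr.
under [RHS]eq_bigr do rewrite ga_mulE mulr_suml.
rewrite [RHS]exchange_big; apply: eq_bigr => y _ /=.
rewrite [RHS](reindex_inj (mulgI y)) /=; apply: eq_bigr => z _.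
by rewrite mulrA mulKg invMg mulgA.
Qed.

Fact ga_mul1 : left_id (gd 1%g) ga_mul.
Proof.
move=> a; apply/ffunP=> x; rewrite ga_mulE (bigD1 1%g) //= gdE eqxx invg1 mul1g mul1r.
by rewrite big1 ?addr0 // => y /negPf y1; rewrite gdE y1 mul0r.
Qed.

Fact ga_mulr1 : right_id (gd 1%g) ga_mul.
Proof.
move=> a; apply/ffunP=> x; rewrite ga_mulE (bigD1 x) //= gdE mulVg eqxx mulr1.
rewrite big1 ?addr0 // => y /negPf yx; rewrite gdE -eq_mulVg1 yx mulr0 //.
Qed.

Fact ga_mulDl : left_distributive ga_mul +%R.
Proof.
move=> a b c; apply/ffunP=> x; rewrite ga_addE !ga_mulE -big_split /=.
by apply: eq_bigr => y _; rewrite ga_addE mulrDl.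
Qed.

Fact ga_mulDr : right_distributive ga_mul +%R.
Proof.
move=> a b c; apply/ffunP=> x; rewrite ga_addE !ga_mulE -big_split /=.
by apply: eq_bigr => y _; rewrite ga_addE mulrDr.
Qed.

Fact ga_one_neq0 : gd 1%g != 0 :> A.
Proof.
by apply/eqP => /ffunP/(_ 1%g)/eqP; rewrite gdE ffunE eqxx oner_eq0.
Qed.

HB.instance Definition _ := GRing.Zmodule_isNzRing.Build A
  ga_mulA ga_mul1 ga_mulr1 ga_mulDl ga_mulDr ga_one_neq0.

Lemma gaME (a b : A) x : (a * b) x = \sum_y a y * b (y^-1 * x)%g.
Proof. exact: ga_mulE. Qed.

Fact ga_scaleAl (c : k) (a b : A) : c *: (a * b) = c *: a * b.
Proof.
by apply/ffunP=> x; rewrite ga_scaleE !gaME mulr_sumr; apply: eq_bigr => y _; rewrite ga_scaleE mulrA.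
Qed.

HB.instance Definition _ := GRing.Lmodule_isLalgebra.Build k A ga_scaleAl.

Fact ga_scaleAr (c : k) (a b : A) : c *: (a * b) = a * (c *: b).
Proof.
by apply/ffunP=> x; rewrite ga_scaleE !gaME mulr_sumr; apply: eq_bigr => y _; rewrite ga_scaleE mulrCA.
Qed.

HB.instance Definition _ := GRing.Lalgebra_isAlgebra.Build k A ga_scaleAr.

Lemma ga_sumE I r (P : pred I) (F : I -> A) x : (\sum_(i <- r | P i) F i) x = \sum_(i <- r | P i) F i x.
Proof. by rewrite (big_morph (fun a : A => a x) (fun a b => ga_addE a b x) (ffunE _ _)). Qed.

Lemma gd1 : gd 1%g = 1 :> A. Proof. by []. Qed.

Lemma gdMl g (a : A) x : (gd g * a) x = a (g^-1 * x)%g.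
Proof.
rewrite gaME (bigD1 g) //= gdE eqxx mul1r big1 ?addr0 // => y /negPf yg.
by rewrite gdE yg mul0r.
Qed.

Lemma gdMr g (a : A) x : (a * gd g) x = a (x * g^-1)%g.
Proof.
rewrite gaME (bigD1 (x * g^-1)%g) //= gdE invMg invgK mulgKV eqxx mulr1 big1 ?addr0 // => y yg.
rewrite gdE (_ : _ == _ = false) ?mulr0 //; apply: contraNF yg => /eqP <-.
by rewrite invMg invgK mulKVg.
Qed.

Lemma gdM g h : gd g * gd h = gd (g * h)%g.
Proof. by apply/ffunP=> x; rewrite gdMl !gdE -(inj_eq (mulgI g)) mulKVg. Qed.

Lemma ga_expand (a : A) : a = \sum_g a g *: gd g.
Proof.
apply/ffunP=> x; rewrite ga_sumE (bigD1 x) //= ga_scaleE gdE eqxx mulr1.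
by rewrite big1 ?addr0 // => y /negPf yx; rewrite ga_scaleE gdE eq_sym yx mulr0.
Qed.

End GroupAlgebraRing.

(** * Hopf structure of the group algebra *)

Section HopfStructure.
Variables (k : fieldType) (gT : finGroupType).
Local Notation A := (ga k gT).
Local Notation AA := (ga k (gT * gT)%type).

Lemma linear_expand (M : lmodType k) (hT : finGroupType) (F : ga k hT -> M) a :
  linear F -> F a = \sum_g a g *: F (gd k g).
Proof.
move=> linF; have F0 : F 0 = 0 by have:= linF (-1) 0 0; rewrite scaler0 addr0 scaleN1r addNr.
rewrite {1}[a]ga_expand; elim/big_rec2: _ => // g y x _ <-; exact: linF.
Qed.

Definition tn (a b : A) : AA := tens a b.
Definition cop (a : A) : AA := gDelta a.
Definition antip (a : A) : A := gS a.
Definition eps (a : A) : k := \sum_g a g.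
(** The linear map induced by [f] on the tensor square, prescribed on pairs of group elements so
    that bilinearity of [f] enters only in [lift2_tn]. Sweedler sums take the form
    [lift2 f (Delta a)]. *)
Definition lift2 (M : lmodType k) (f : A -> A -> M) (t : AA) : M :=
  \sum_p t p *: f (gd k p.1) (gd k p.2).

Lemma tnE a b p : tn a b p = a p.1 * b p.2.
Proof. by rewrite ffunE. Qed.

Lemma tn_linl b : linear (tn^~ b).
Proof. by move=> c u v; apply/ffunP=> p; rewrite ga_addE ga_scaleE !tnE ga_addE ga_scaleE mulrDl mulrA. Qed.

Lemma tn_linr a : linear (tn a).
Proof. by move=> c u v; apply/ffunP=> p; rewrite ga_addE ga_scaleE !tnE ga_addE ga_scaleE mulrDr mulrCA. Qed.

(** Swapped arguments let linearity in the first leg be registered on a partial application. *)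
Definition tnr (b a : A) : AA := tn a b.
HB.instance Definition _ b := GRing.isLinear.Build k A AA _ (tnr b) (tn_linl b).
HB.instance Definition _ a := GRing.isLinear.Build k A AA _ (tn a) (tn_linr a).

Lemma tn_suml I r (P : pred I) (F : I -> A) b :
  tn (\sum_(i <- r | P i) F i) b = \sum_(i <- r | P i) tn (F i) b.
Proof. exact: (linear_sum (tnr b)). Qed.
Lemma tn_sumr I r (P : pred I) (F : I -> A) a :
  tn a (\sum_(i <- r | P i) F i) = \sum_(i <- r | P i) tn a (F i).
Proof. exact: (linear_sum (tn a)). Qed.
Lemma tnZl c a b : tn (c *: a) b = c *: tn a b. Proof. exact: (linearZ_LR (tnr b)). Qed.
Lemma tnZr c a b : tn a (c *: b) = c *: tn a b. Proof. exact: (linearZ_LR (tn a)). Qed.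

Lemma tnM a b c d : tn a b * tn c d = tn (a * c) (b * d).
Proof.
apply/ffunP=> p; rewrite tnE !gaME mulr_suml.
under [RHS]eq_bigr do rewrite mulr_sumr.
by rewrite pair_bigA; apply: eq_bigr => q _; rewrite !tnE mulrACA.
Qed.

Lemma tn_gd g h : tn (gd k g) (gd k h) = gd k (g, h).
Proof. by apply/ffunP=> -[x y]; rewrite tnE !gdE -natrM mulnb. Qed.

Lemma tn11 : tn 1 1 = 1. Proof. exact: tn_gd. Qed.

Lemma tensor_expand (t : AA) : t = \sum_p t p *: tn (gd k p.1) (gd k p.2).
Proof. by rewrite {1}[t]ga_expand; apply: eq_bigr => -[g h] _; rewrite tn_gd. Qed.

Lemma lift2_linear (M : lmodType k) (f : A -> A -> M) : linear (lift2 f).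
Proof.
move=> c u v; rewrite /lift2 scaler_sumr -big_split; apply: eq_bigr => p _.
by rewrite ga_addE ga_scaleE scalerDl scalerA.
Qed.
HB.instance Definition _ (M : lmodType k) (f : A -> A -> M) := GRing.isLinear.Build k AA M _ (@lift2 M f) (@lift2_linear M f).

Lemma lift2_tn (M : lmodType k) (f : A -> A -> M) a b :
  (forall y, linear (f^~ y)) -> (forall x, linear (f x)) -> lift2 f (tn a b) = f a b.
Proof.
move=> fl fr; rewrite (linear_expand a (fl b)) /=.
under [RHS]eq_bigr do rewrite (linear_expand b (fr _)) scaler_sumr.
rewrite pair_bigA; apply: eq_bigr => p _; by rewrite tnE scalerA.
Qed.

Lemma copE a p : cop a p = if p.1 == p.2 then a p.1 else 0.
Proof. by rewrite ffunE. Qed.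

Lemma cop_linear : linear cop.
Proof.
move=> c u v; apply/ffunP=> p; rewrite ga_addE ga_scaleE !copE.
by case: eqP => _; rewrite ?ga_addE ?ga_scaleE // mulr0 addr0.
Qed.
HB.instance Definition _ := GRing.isLinear.Build k A AA _ cop cop_linear.

Lemma cop_gd g : cop (gd k g) = tn (gd k g) (gd k g).
Proof.
apply/ffunP=> -[x y]; rewrite copE tnE !gdE /= -natrM mulnb.
case: (x =P y) => [->|xy] /=; first by rewrite andbb.
by case: (x =P g) => //= xg; case: (y =P g) => //= yg; case: xy; rewrite xg yg.
Qed.

Lemma cop_mul : {morph cop : a b / a * b}.
Proof.
move=> a b; rewrite [a]ga_expand [b]ga_expand mulr_suml !linear_sum /= mulr_suml; apply: eq_bigr => g _.
rewrite mulr_sumr !linear_sum mulr_sumr; apply: eq_bigr => h _.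
by rewrite -scalerAl -scalerAr !linearZ /= -scalerAl -scalerAr gdM !cop_gd tnM gdM.
Qed.

Lemma antipE a g : antip a g = a g^-1%g. Proof. by rewrite ffunE. Qed.

Lemma antip_linear : linear antip.
Proof. by move=> c u v; apply/ffunP=> p; rewrite ga_addE ga_scaleE !antipE ga_addE ga_scaleE. Qed.
HB.instance Definition _ := GRing.isLinear.Build k A A _ antip antip_linear.

Lemma antip_gd g : antip (gd k g) = gd k g^-1%g.
Proof. by apply/ffunP=> x; rewrite antipE !gdE -(inj_eq invg_inj) invgK. Qed.

Lemma antipM a b : antip (a * b) = antip b * antip a.
Proof.
rewrite [a]ga_expand [b]ga_expand mulr_suml !linear_sum /= mulr_sumr; apply: eq_bigr => g _.
rewrite mulr_sumr !linear_sum mulr_suml; apply: eq_bigr => h _.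
rewrite -scalerAl -scalerAr !linearZ /= -scalerAl -scalerAr gdM !antip_gd gdM.
by rewrite invMg !scalerA mulrC.
Qed.

Lemma antipK : involutive antip.
Proof. by move=> a; apply/ffunP=> g; rewrite !antipE invgK. Qed.

Lemma eps_linear : linear (eps : A -> k^o).
Proof.
move=> c u v; rewrite /eps /GRing.scale /= mulr_sumr -big_split; apply: eq_bigr => p _.
by rewrite ga_addE ga_scaleE.
Qed.
HB.instance Definition _ := GRing.isLinear.Build k A k^o _ (eps : A -> k^o) eps_linear.

Lemma eps_gd g : eps (gd k g) = 1.
Proof. by rewrite /eps (bigD1 g) //= gdE eqxx big1 ?addr0 // => h /negPf hg; rewrite gdE hg. Qed.

Lemma epsZ c a : eps (c *: a) = c * eps a. Proof. exact: (linearZ_LR eps). Qed.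
Lemma epsD a b : eps (a + b) = eps a + eps b. Proof. exact: (linearD eps). Qed.
Lemma eps_sum I r (P : pred I) (F : I -> A) :
  eps (\sum_(i <- r | P i) F i) = \sum_(i <- r | P i) eps (F i).
Proof. exact: (linear_sum eps). Qed.

Lemma epsM a b : eps (a * b) = eps a * eps b.
Proof.
rewrite [a]ga_expand [b]ga_expand mulr_suml !eps_sum mulr_suml; apply: eq_bigr => g _.
rewrite mulr_sumr !eps_sum mulr_sumr; apply: eq_bigr => h _.
by rewrite -scalerAl -scalerAr !epsZ gdM !eps_gd !mulr1.
Qed.

Lemma eps1 : eps 1 = 1. Proof. exact: eps_gd. Qed.

Lemma eps_antip a : eps (antip a) = eps a.
Proof. by rewrite /eps (reindex_inj invg_inj); apply: eq_bigr => g _; rewrite antipE invgK. Qed.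

End HopfStructure.

(** * Slicing tensors by linear functionals *)

Section Slices.
Variables (k : fieldType) (gT : finGroupType).
Local Notation A := (ga k gT).
Local Notation AA := (ga k (gT * gT)%type).
Implicit Types c : {linear A -> k^o}.

(** [slr] is id (x) c and keeps the left leg; [sll] is c (x) id and keeps the right leg. *)
Definition slr (c : A -> k) (t : AA) : A := lift2 (fun a b => c b *: a) t.
Definition sll (c : A -> k) (t : AA) : A := lift2 (fun a b => c a *: b) t.

HB.instance Definition _ c := GRing.isLinear.Build k AA A _ (slr c) (lift2_linear _).
HB.instance Definition _ c := GRing.isLinear.Build k AA A _ (sll c) (lift2_linear _).

Lemma slr_tn c a b : slr c (tn a b) = (c b : k) *: a.
Proof.
rewrite /slr lift2_tn // => [y d u w|x d u w]; first by rewrite scalerDr !scalerA mulrC.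
by rewrite linearP scalerDl scalerA.
Qed.

Lemma sll_tn c a b : sll c (tn a b) = (c a : k) *: b.
Proof.
rewrite /sll lift2_tn // => [y d u w|x d u w]; last by rewrite scalerDr !scalerA mulrC.
by rewrite linearP scalerDl scalerA.
Qed.

Lemma slr_mull c t x : slr c (t * tn x 1) = slr c t * x.
Proof.
rewrite {1}[t]tensor_expand mulr_suml linear_sum mulr_suml; apply: eq_bigr => p _.
by rewrite -scalerAl linearZ /= tnM mulr1 slr_tn -!scalerAl.
Qed.

Lemma eps_slr c t : eps (slr c t) = c (lift2 (fun a b => eps a *: b) t).
Proof.
rewrite [LHS](linear_sum (@eps k gT : A -> k^o)) [RHS]linear_sum; apply: eq_bigr => p _.
by rewrite !linearZ /= !linearZ /= /GRing.scale /= mulrCA [RHS]mulrCA [c _ * _]mulrC.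
Qed.

Definition tensor_sub (B : A -> Prop) (t : AA) : Prop :=
  exists (m : nat) (x y : 'I_m -> A),
    (forall i, B (x i) /\ B (y i)) /\ t = \sum_(i < m) tn (x i) (y i).

End Slices.

(** * Bases of subspaces given as predicates *)

Section SubspaceBasis.
Variables (k : fieldType) (A : vectType k) (B : A -> Prop).
Hypothesis B0 : B 0.
Hypothesis BP : forall c a b, B a -> B b -> B (c *: a + b).

(** Starting from the zero space, a vector of [B] outside the current subspace is adjoined as long
    as one exists, which is decided classically. Codimension bounds the number of rounds. *)
Lemma subspace_vspace : exists U : {vspace A}, forall x, B x <-> x \in U.
Proof.
have ext n : forall U : {vspace A}, (forall x, x \in U -> B x) ->
    (\dim {:A} - \dim U <= n)%N -> exists U : {vspace A}, forall x, B x <-> x \in U.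
  elim: n => [|n IH] U UB dimU.
    have /eqP UT : U == fullv by rewrite eqEdim subvf /= -subn_eq0 -leqn0.
    by exists U => x; split=> [_|/UB//]; rewrite UT memvf.
  case: (classic (forall x, B x -> x \in U)) => [allB|nB].
    by exists U => x; split; [exact: allB | exact: UB].
  have [x nx] := not_all_ex_not _ _ nB; have [Bx xU] := imply_to_and _ _ nx.
  apply: (IH (U + <[x]>)%VS).
    by move=> y /memv_addP[u /UB Bu [w /vlineP[c ->] ->]]; rewrite addrC; apply: BP.
  have: (\dim U < \dim (U + <[x]>))%N.
    rewrite ltnNge; apply: contra_notN xU => dimle.
    have /eqP-> : U == (U + <[x]>)%VS by rewrite eqEdim addvSl.
    by rewrite (subvP (addvSr _ _)) ?memv_line.
  have: (\dim (U + <[x]>) <= \dim {:A})%N by rewrite dimvS ?subvf.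
  move: dimU; move: (\dim (U + <[x]>)%VS) => d; lia.
by apply: (ext (\dim {:A}) 0%VS); [move=> x /[!memv0]/eqP-> | rewrite leq_subr].
Qed.

(** The dual functionals live on all of [A], so they can slice any tensor; the expansion holds on
    [B]. *)
Lemma subspace_basis : exists m (b : 'I_m -> A) (c : 'I_m -> {linear A -> k^o}),
  [/\ forall i, B (b i), forall i j, c i (b j) = (i == j)%:R
    & forall x, B x -> x = \sum_i (c i x : k) *: b i].
Proof.
have [U UB] := subspace_vspace.
exists (\dim U), (fun i => (vbasis U)`_i), (fun i => coord (vbasis U) i); split.
- by move=> i; apply/UB/vbasis_mem/mem_nth; rewrite size_tuple.
- by move=> i j /=; rewrite coord_free ?(basis_free (vbasisP U)) // eq_sym.
- by move=> x /UB; exact: coord_vbasis.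
Qed.
End SubspaceBasis.

(** * The given operations expressed through the ring structure *)

Section Translation.
Variables (k : fieldType) (gT : finGroupType).
Local Notation A := (ga k gT).
Local Notation AA := (ga k (gT * gT)%type).

Lemma gscaleE c (a : A) : gscale c a = c *: a.
Proof. by apply/ffunP=> g; rewrite [LHS]ffunE ga_scaleE. Qed.

Lemma tscaleE c (t : AA) : tscale c t = c *: t.
Proof. by apply/ffunP=> g; rewrite [LHS]ffunE ga_scaleE. Qed.

Lemma tmulE (t u : AA) : tmul t u = t * u.
Proof. by apply/ffunP=> p; rewrite [LHS]ffunE gaME; apply: eq_bigr. Qed.

Lemma toneE : tone gT k = 1 :> AA.
Proof. by apply/ffunP=> p; rewrite [LHS]ffunE -gd1 gdE. Qed.

(** An inverse exists, so the chosen element satisfies its specification, and two-sided inverses are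
    unique. *)
Lemma tinvE (t u : AA) : t * u = 1 -> u * t = 1 -> tinv t = u.
Proof.
move=> tu ut; have [] := epsilon_spec (inhabits (0 : talg gT k))
  (fun u => tmul t u = tone gT k /\ tmul u t = tone gT k).
  by exists u; rewrite !tmulE toneE.
rewrite -/(tinv t) !tmulE toneE => tu' _.
by rewrite -[RHS]mulr1 -tu' mulrA ut mul1r.
Qed.

Lemma ginvE (a b : A) : a * b = 1 -> b * a = 1 -> ginv a = b.
Proof.
move=> ab ba; have [] := epsilon_spec (inhabits (0 : galg gT k))
  (fun b => gmul a b = gone gT k /\ gmul b a = gone gT k) (ex_intro _ b (conj ab ba)).
rewrite -/(ginv a) => ab' _; have {}ab' : a * (ginv a : A) = 1 by [].
transitivity (b * (a * (ginv a : A))); first by rewrite mulrA ba mul1r.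
by rewrite ab' mulr1.
Qed.

Lemma twist_vE (t : AA) : twist_v t = lift2 (fun a b => antip a * b) t.
Proof. by apply: eq_bigr => p _; rewrite gscaleE antip_gd gdM. Qed.

End Translation.

(** The coefficients at [g] are compared: on the left it is the coefficient of the sum at the
    identity, namely 1, and on the right it is the indicator of [N] at [g]. *)
Lemma gd_in_stabilizer (k : fieldType) (gT : finGroupType) (N : {group gT}) g :
  gd k g * (\sum_(h in N) gd k h) = eps (gd k g) *: (\sum_(h in N) gd k h) -> g \in N.
Proof.
rewrite eps_gd scale1r => /ffunP/(_ g); rewrite gdMl mulVg.
have sumE x : (\sum_(h in N) gd k h) x = (x \in N)%:R.
  rewrite ga_sumE; case: (boolP (x \in N)) => xN.
    rewrite (bigD1 x) //= gdE eqxx big1 ?addr0 // => h /andP[_ hx].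
    by rewrite gdE eq_sym (negPf hx).
  by rewrite big1 // => h hN; rewrite gdE; case: eqP => // xh; rewrite xh hN in xN.
by rewrite !sumE group1; case: (g \in N) => // /eqP; rewrite oner_eq0.
Qed.

(** * The integral of a normal Hopf subalgebra *)

Section Integral.
Variables (k : fieldType) (gT : finGroupType).
Local Notation A := (ga k gT).
Local Notation AA := (ga k (gT * gT)%type).
Variables (F Fi : AA) (Delta : {linear A -> AA}) (S : {linear A -> A}) (B : A -> Prop).
Let ad x a : A := lift2 (fun b c => b * x * S c) (Delta a).

Hypothesis k0 : [pchar k] =i pred0.
Hypothesis FFi : F * Fi = 1.
Hypothesis DeltaE : forall a, Delta a = Fi * cop a * F.
Hypothesis SM : forall a b, S (a * b) = S b * S a.
Hypothesis SK : involutive S.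
Hypothesis eps_S : forall a, eps (S a) = eps a.
Hypothesis counitl : forall a, lift2 (fun b c => eps b *: c) (Delta a) = a.
Hypothesis counitr : forall a, lift2 (fun b c => eps c *: b) (Delta a) = a.
Hypothesis S_conv : forall a, lift2 (fun b c => S c * b) (Delta a) = eps a *: 1.
(** In Sweedler notation: a_1 (x) a_2 S(a_3) = a (x) 1. Likewise [ad_mul] reads a_1 x S(a_2) a_3 = a
    x. *)
Hypothesis S_counitr : forall a, lift2 (fun b c => Delta b * tn 1 (S c)) (Delta a) = tn a 1.
Hypothesis ad_mul : forall x a, lift2 (fun b c => ad x b * c) (Delta a) = a * x.
Hypothesis eps_ad : forall x a, eps (ad x a) = eps a * eps x.

Hypothesis B0 : B 0.
Hypothesis BP : forall c a b, B a -> B b -> B (c *: a + b).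
Hypothesis B1 : B 1.
Hypothesis BM : forall a b, B a -> B b -> B (a * b).
Hypothesis BDelta : forall a, B a -> tensor_sub B (Delta a).
Hypothesis BS : forall a, B a -> B (S a).
Hypothesis Bad : forall x a, B x -> B (ad x a).

Lemma BZ c a : B a -> B (c *: a).
Proof. by move=> Ba; rewrite -[c *: a]addr0; apply: BP. Qed.

Lemma B_sum I (r : seq I) (P : pred I) (G : I -> A) :
  (forall i, P i -> B (G i)) -> B (\sum_(i <- r | P i) G i).
Proof.
move=> BG; elim/big_rec: _ => [|i x Pi Bx]; first exact: B0.
by rewrite -[G i]scale1r; apply: BP => //; apply: BG.
Qed.

Lemma tensor_sub_slr (c : {linear A -> k^o}) t : tensor_sub B t -> B (slr c t).
Proof.
move=> [m [x [y [Bxy ->]]]]; rewrite linear_sum; apply: B_sum => i _.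
by rewrite /= slr_tn; apply: BZ; case: (Bxy i).
Qed.

Lemma tensor_sub_sll (c : {linear A -> k^o}) t : tensor_sub B t -> B (sll c t).
Proof.
move=> [m [x [y [Bxy ->]]]]; rewrite linear_sum; apply: B_sum => i _.
by rewrite /= sll_tn; apply: BZ; case: (Bxy i).
Qed.

Lemma DeltaM a b : Delta (a * b) = Delta a * Delta b.
Proof. by rewrite !DeltaE cop_mul -!mulrA (mulrA F) FFi mul1r. Qed.

(* [Lam0] represents the functional f |-> Tr_B (b |-> b_1 f(b_2)). Right invariance
   is cyclicity of the trace, using S(x_2) x_1 = eps(x), valid as S is involutive. *)
Lemma right_integral : exists Lam, [/\ B Lam, eps Lam = 1
  & forall x, B x -> Lam * x = eps x *: Lam].
Proof.
have [m [b [c [Bb cb expB]]]] := subspace_basis B0 BP.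
pose Lam0 : A := \sum_i slr (c i) (Delta (b i)).
(* [m] is the dimension of [B], positive because [B] contains 1, and hence nonzero in characteristic
   zero. *)
have m0 : m%:R != 0 :> k.
  have /pcharf0P-> := k0.
  apply/eqP => m0; move: b c Bb cb expB {Lam0}; rewrite m0 => b c _ _ /(_ _ B1).
  by rewrite big_ord0 => /eqP; rewrite oner_eq0.
(* By the counit law, this is the trace of the identity of [B]. *)
have epsLam0 : eps Lam0 = m%:R.
  rewrite eps_sum; under eq_bigr do rewrite eps_slr counitl cb eqxx.
  by rewrite sumr_const card_ord.
have Lam0x x : B x -> Lam0 * x = eps x *: Lam0.
  move=> Bx; have [p [y [z [Byz Dx]]]] := BDelta Bx.
  have tx : tn x 1 = \sum_j Delta (y j) * tn 1 (S (z j)).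
    rewrite -S_counitr Dx linear_sum; apply: eq_bigr => j _ /=.
    rewrite lift2_tn // => [w d u u'|w d u u']; first by rewrite linearP mulrDl -scalerAl.
    by rewrite linearP linearP mulrDr -scalerAr.
  have convx : \sum_j S (z j) * y j = eps x *: 1.
    rewrite -S_conv Dx linear_sum; apply: eq_bigr => j _ /=.
    rewrite lift2_tn // => [w d u u'|w d u u']; first by rewrite mulrDr -scalerAr.
    by rewrite linearP mulrDl -scalerAl.
  (* The terms obtained by writing x (x) 1 through [S_counitr] and expanding [b i * y j] in the
     basis. *)
  pose G i j l : A := (c l (b i * y j) : k) *: slr (c i) (Delta (b l) * tn 1 (S (z j))).
  transitivity (\sum_i \sum_j \sum_l G i j l).
    rewrite mulr_suml; apply: eq_bigr => i _; rewrite -slr_mull tx mulr_sumr linear_sum.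
    apply: eq_bigr => j _; rewrite mulrA -DeltaM {1}(expB (b i * y j)); last first.
      by apply: BM => //; case: (Byz j).
    rewrite linear_sum mulr_suml linear_sum; apply: eq_bigr => l _.
    by rewrite linearZ -scalerAl linearZ.
  transitivity (\sum_l \sum_i \sum_j G i j l).
    by rewrite [RHS]exchange_big; apply: eq_bigr => i _; rewrite exchange_big.
  rewrite scaler_sumr.
  apply: eq_bigr => l _; rewrite exchange_big /=.
  have [q [s [t [Bst Dl]]]] := BDelta (Bb l).
  transitivity (\sum_j \sum_r (c l (t r * (S (z j) * y j)) : k) *: s r).
    apply: eq_bigr => j _.
    transitivity (\sum_i \sum_r (c i (t r * S (z j)) * c l (b i * y j) : k) *: s r).
      apply: eq_bigr => i _; rewrite /G Dl mulr_suml (linear_sum (slr (c i))) /= scaler_sumr; apply: eq_bigr => r _.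
      by rewrite /= tnM mulr1 slr_tn scalerA mulrC.
    rewrite exchange_big; apply: eq_bigr => r _; rewrite -scaler_suml; congr (_ *: _).
    (* Contracting the dual basis over [i] merges the two functionals into one; this is the
       cyclicity of the trace. *)
    rewrite mulrA {2}(expB (t r * S (z j))); last first.
      by apply: BM; [case: (Bst r)|apply: BS; case: (Byz j)].
    rewrite mulr_suml linear_sum; apply: eq_bigr => i _.
    by rewrite -scalerAl linearZ.
  rewrite exchange_big Dl (linear_sum (slr (c l))) /= scaler_sumr; apply: eq_bigr => r _.
  rewrite -scaler_suml /= slr_tn scalerA; congr (_ *: _).
  transitivity (c l (t r * (eps x *: 1))); last by rewrite -scalerAr mulr1 linearZ.
  by rewrite -convx mulr_sumr linear_sum.
exists (m%:R^-1 *: Lam0); split.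
- by apply: BZ; apply: B_sum => i _; apply: tensor_sub_slr; apply: BDelta.
- by rewrite epsZ epsLam0 mulVf.
- by move=> x Bx; rewrite -scalerAl Lam0x // !scalerA mulrC.
Qed.

(** The antihomomorphism [S] turns the right integral into a left one. The product [Lam * S Lam]
    then equals both [Lam] and [S Lam], as each has counit 1. *)
Lemma integral : exists Lam, [/\ B Lam, eps Lam = 1,
  forall x, B x -> Lam * x = eps x *: Lam, forall x, B x -> x * Lam = eps x *: Lam
  & S Lam = Lam].
Proof.
have [Lam [BLam epsLam Lamx]] := right_integral.
have xSLam x : B x -> x * S Lam = eps x *: S Lam.
  by move=> Bx; rewrite -{1}[x]SK -SM (Lamx _ (BS Bx)) linearZ_LR eps_S.
have SLam : S Lam = Lam.
  have := Lamx _ (BS BLam); rewrite (xSLam _ BLam) eps_S epsLam !scale1r //.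
by exists Lam; split=> // x Bx; rewrite -SLam xSLam.
Qed.

(** By [ad_mul], h Lam is a sum of terms (h_1 . Lam) h_2 whose first factors lie in [B], so the
    integral absorbs them and Lam h Lam = Lam h. Applying [S] gives the mirror identity Lam h Lam =
    h Lam. *)
Lemma integral_central Lam : B Lam -> eps Lam = 1 ->
  (forall x, B x -> Lam * x = eps x *: Lam) -> S Lam = Lam ->
  forall h, Lam * h = h * Lam.
Proof.
move=> BLam epsLam Lamx SLam.
have LhL h : Lam * h * Lam = Lam * h.
  rewrite -mulrA -[h * Lam]ad_mul -[in RHS](counitl h) /lift2 !mulr_sumr; apply: eq_bigr => p _.
  rewrite -!scalerAr mulrA Lamx; last exact: Bad.
  by rewrite eps_ad epsLam mulr1 -scalerAl.
move=> h; have : S (Lam * S h * Lam) = S (Lam * S h) by rewrite LhL.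
by rewrite !SM SLam SK mulrA LhL.
Qed.

Lemma hopf_integral_subgroup : exists N : {group gT}, [/\ (N <| [set: gT])%g,
  B (\sum_(g in N) gd k g)
  & forall x, B x -> x * (\sum_(g in N) gd k g) = eps x *: (\sum_(g in N) gd k g)].
Proof.
have [Lam [BLam epsLam Lamx xLam SLam]] := integral.
have Lamc := integral_central BLam epsLam Lamx SLam.
(* The right legs of the coproduct lie in [B], so the integral absorbs them and the counit law
   leaves the left leg. *)
have DLam : Delta Lam * tn 1 Lam = tn Lam Lam.
  have [m [x [y [Bxy DL]]]] := BDelta BLam.
  rewrite -{3}(counitr Lam) DL mulr_suml linear_sum tn_suml; apply: eq_bigr => i _ /=.
  rewrite tnM mulr1 lift2_tn => [|z c a b|z c a b].
  - by rewrite xLam ?tnZl ?tnZr //; case: (Bxy i).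
  - by rewrite scalerDr !scalerA mulrC.
  - by rewrite epsD epsZ scalerDl scalerA.
have tnc : forall t, tn 1 Lam * t = t * tn 1 Lam.
  move=> t; rewrite [t]tensor_expand mulr_suml mulr_sumr; apply: eq_bigr => p _.
  by rewrite -scalerAl -scalerAr !tnM mulr1 mul1r Lamc.
(* Both 1 (x) Lam and Lam (x) Lam are central, so conjugation by [F] disappears. *)
have copLam : cop Lam * tn 1 Lam = tn Lam Lam.
  have FLam : F * tn Lam Lam * Fi = tn Lam Lam.
    have -> : tn Lam Lam = tn Lam 1 * tn 1 Lam by rewrite tnM mulr1 mul1r.
    have tnc' : forall t, tn Lam 1 * t = t * tn Lam 1.
      move=> t; rewrite [t]tensor_expand mulr_suml mulr_sumr; apply: eq_bigr => p _.
      by rewrite -scalerAl -scalerAr !tnM mulr1 mul1r Lamc.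
    by rewrite -!mulrA tnc mulrA -tnc' -!mulrA (mulrA F) FFi mul1r.
  rewrite -[RHS]FLam -DLam DeltaE -!mulrA tnc (mulrA F Fi) FFi mul1r.
  by rewrite (mulrA F Fi) FFi mul1r.
(* This is the coefficient of [copLam] at [(g, h)]. It makes the support of [Lam] a subgroup on
   which [Lam] is constant. *)
have key g h : Lam g * Lam (g^-1 * h)%g = Lam g * Lam h.
  rewrite -[RHS](tnE Lam Lam (g, h)) -copLam (linear_expand Lam (@cop_linear k gT)).
  rewrite mulr_suml ga_sumE (bigD1 g) //= cop_gd -scalerAl tnM ga_scaleE tnE /= mulr1.
  rewrite gdE eqxx mul1r gdMl big1 ?addr0 // => x /negPf xg.
  by rewrite cop_gd -scalerAl tnM ga_scaleE tnE /= mulr1 gdE eq_sym xg mul0r mulr0.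
have key' g h : Lam g != 0 -> Lam (g^-1 * h)%g = Lam h by move=> g0; apply: (mulfI g0).
have Lam1 g : Lam g != 0 -> Lam g = Lam 1%g by move=> g0; rewrite -(key' g) // mulVg.
have Lam10 : Lam 1%g != 0.
  apply/eqP => L1; have : eps Lam == 0.
    rewrite /eps big1 // => g _; case: (eqVneq (Lam g) 0) => // g0.
    by rewrite Lam1 // L1.
  by rewrite epsLam oner_eq0.
have gN : group_set [set g | Lam g != 0].
  apply/group_setP; split=> [|g h]; rewrite !inE // => g0 h0.
  by rewrite -(key' g) // mulKg.
pose N := Group gN.
have LamN : Lam = Lam 1%g *: \sum_(g in N) gd k g.
  rewrite {1}[Lam]ga_expand scaler_sumr [RHS]big_mkcond; apply: eq_bigr => g _.
  rewrite inE; case: eqP => [->|/eqP g0]; first by rewrite scale0r.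
  by rewrite Lam1.
have NLam : \sum_(g in N) gd k g = (Lam 1%g)^-1 *: Lam.
  by rewrite {2}LamN scalerA mulVf ?scale1r.
exists N; rewrite NLam; split; [|exact: BZ|by move=> x Bx; rewrite -scalerAr xLam // !scalerA mulrC].
apply/normalP; split=> [|x _]; first exact: subsetT.
apply/setP => g; rewrite mem_conjg !inE.
have /ffunP/(_ (x * g)%g) := Lamc (gd k x).
by rewrite gdMl gdMr mulKg /conjg invgK mulgA => ->.
Qed.

End Integral.

(** * Twisting by a cocycle on an elementary abelian 2-group *)

Section Twist.
Variables (k : fieldType) (gT : finGroupType) (V : finZmodType).
Local Notation A := (ga k gT).
Local Notation AA := (ga k (gT * gT)%type).
(** [V] plays two roles: through [eta] it parametrises the subgroup H, and through the pairing [s]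
    its elements are also the characters of H. *)
Variables (eta : V -> gT) (s W : V -> V -> k).
Local Notation q := (#|V|%:R : k).

Hypothesis V2 : forall x : V, x + x = 0.
Hypothesis q0 : q != 0.
Hypothesis etaD : forall x y, eta (x + y) = (eta x * eta y)%g.
Hypothesis s0l : forall z, s 0 z = 1.
Hypothesis s0r : forall x, s x 0 = 1.
Hypothesis sDl : forall x y z, s (x + y) z = s x z * s y z.
Hypothesis sDr : forall x y z, s x (y + z) = s x y * s x z.
Hypothesis s_suml : forall z, \sum_x s x z = (z == 0)%:R * q.
Hypothesis s_sumr : forall x, \sum_z s x z = (x == 0)%:R * q.
Hypothesis W0 : forall x y, W x y != 0.
Hypothesis Wc : forall a b c, W a b * W (a + b) c = W b c * W a (b + c).

Lemma eta0 : eta 0 = 1%g.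
Proof. by apply: (mulgI (eta 0)); rewrite -etaD addr0 mulg1. Qed.

Lemma etaV x : (eta x)^-1%g = eta x.
Proof. by apply/eqP; rewrite eq_invg_mul -etaD V2 eta0. Qed.

Lemma addV_eq0 (x y : V) : (x + y == 0) = (x == y).
Proof. by rewrite -(inj_eq (addIr y)) -addrA V2 addr0 add0r. Qed.

Lemma sum_delta (M : lmodType k) (F : V -> M) y : \sum_x (x == y)%:R *: F x = F y.
Proof. by rewrite (bigD1 y) //= eqxx scale1r big1 ?addr0 // => x /negPf->; rewrite scale0r. Qed.

(* The idempotents e_chi, with the character group identified with [V]. Locked,
   because rewriting with [scalerA] otherwise unfolds them. *)
Definition E : V -> A := locked (fun x => q^-1 *: \sum_z s x z *: gd k (eta z)).

Lemma EE x : E x = q^-1 *: \sum_z s x z *: gd k (eta z).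
Proof. by rewrite /E -lock. Qed.

Lemma gd_E z x : gd k (eta z) * E x = s x z *: E x.
Proof.
rewrite EE -scalerAr scalerA mulrC -scalerA; congr (_ *: _).
rewrite mulr_sumr scaler_sumr (reindex_inj (addrI z)); apply: eq_bigr => y _.
by rewrite -scalerAr gdM -etaD addrA V2 add0r scalerA sDr.
Qed.

Lemma EM x y : E x * E y = (x == y)%:R *: E x.
Proof.
rewrite {1}EE -scalerAl mulr_suml.
under eq_bigr do rewrite -scalerAl gd_E scalerA -sDl.
rewrite -scaler_suml s_sumr addV_eq0 scalerA mulrCA mulVf // mulr1.
by case: eqP => [->|]; rewrite ?scale0r.
Qed.

Lemma E1 : \sum_x E x = 1.
Proof.
under eq_bigr do rewrite EE.
rewrite -scaler_sumr exchange_big /=.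
under eq_bigr do rewrite -scaler_suml s_suml -scalerA.
by rewrite sum_delta scalerA mulVf // scale1r eta0.
Qed.

Lemma ES x : antip (E x) = E x.
Proof.
rewrite EE linearZ linear_sum; congr (_ *: _); apply: eq_bigr => z _.
by rewrite linearZ /= antip_gd etaV.
Qed.

(** Comultiplication is dual to the product of characters. After expansion into group elements, the
    sum over [y] of [s y (z + z')] keeps only the terms with [z = z']. *)
Lemma Ecop x : cop (E x) = \sum_y tn (E (x + y)) (E y).
Proof.
transitivity (\sum_y (q^-1 * q^-1) *: \sum_z \sum_z' (s x z * s y (z + z')) *: tn (gd k (eta z)) (gd k (eta z'))).
  rewrite -scaler_sumr exchange_big /= EE linearZ linear_sum -scalerA; congr (_ *: _).
  rewrite scaler_sumr; apply: eq_bigr => z _; rewrite exchange_big /=.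
  under eq_bigr do rewrite -scaler_suml -mulr_sumr s_suml addV_eq0 eq_sym mulrCA -scalerA.
  by rewrite sum_delta linearZ /= cop_gd scalerA mulrCA mulVf // mulr1.
apply: eq_bigr => y _; rewrite !EE tnZl tnZr scalerA; congr (_ *: _).
rewrite tn_suml; apply: eq_bigr => z _; rewrite tn_sumr; apply: eq_bigr => z' _.
by rewrite tnZl tnZr scalerA sDl sDr mulrA.
Qed.

Lemma Eeps x : eps (E x) = (x == 0)%:R.
Proof.
rewrite EE epsZ eps_sum; under eq_bigr do rewrite epsZ eps_gd mulr1.
by rewrite s_sumr mulrCA mulVf // mulr1.
Qed.

(** The cocycle need not be normalised; the cocycle identity with two zero arguments still makes [W]
    constant on both axes. *)
Lemma W_0r x : W x 0 = W 0 0.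
Proof. by have := Wc x 0 0; rewrite !addr0 => /(mulIf (W0 _ _)). Qed.
Lemma W_0l x : W 0 x = W 0 0.
Proof. by have := Wc 0 0 x; rewrite !add0r => /(mulIf (W0 _ _)). Qed.

(** The element of the group algebra of H whose value at the character [x] is [f x]; products become
    pointwise. *)
Definition D (f : V -> k) : A := \sum_x f x *: E x.

Lemma eq_D f g : f =1 g -> D f = D g.
Proof. by move=> fg; apply: eq_bigr => x _; rewrite fg. Qed.

Lemma D_E f y : D f * E y = f y *: E y.
Proof.
rewrite mulr_suml -(sum_delta (fun x => f x *: E x) y); apply: eq_bigr => x _.
by rewrite -scalerAl EM !scalerA mulrC.
Qed.

Lemma E_D f y : E y * D f = f y *: E y.
Proof.
rewrite mulr_sumr -(sum_delta (fun x => f x *: E x) y); apply: eq_bigr => x _.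
rewrite -scalerAr EM !scalerA mulrC eq_sym.
by case: eqP => [->//|_]; rewrite !mul0r !scale0r.
Qed.

Lemma DM f g : D f * D g = D (fun x => f x * g x).
Proof.
rewrite {2}/D mulr_sumr; apply: eq_bigr => x _.
by rewrite -scalerAr D_E scalerA mulrC.
Qed.

Lemma DZ c f : D (fun x => c * f x) = c *: D f.
Proof. by rewrite scaler_sumr; apply: eq_bigr => x _; rewrite scalerA. Qed.

Lemma D_const c : D (fun=> c) = c *: 1.
Proof. by rewrite -E1 scaler_sumr. Qed.

Lemma D1 : D (fun=> 1) = 1. Proof. by rewrite D_const scale1r. Qed.

Lemma D_inv f : (forall x, f x != 0) -> D f * D (fun x => (f x)^-1) = 1.
Proof. by move=> f0; rewrite DM -D1; apply: eq_D => x; rewrite divff. Qed.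

Lemma D_invl f : (forall x, f x != 0) -> D (fun x => (f x)^-1) * D f = 1.
Proof. by move=> f0; rewrite DM -D1; apply: eq_D => x; rewrite mulVf. Qed.

Lemma antip_D f : antip (D f) = D f.
Proof. by rewrite linear_sum; apply: eq_bigr => x _; rewrite linearZ /= ES. Qed.

Lemma eps_D f : eps (D f) = f 0.
Proof.
rewrite eps_sum -[RHS](sum_delta (f : V -> k^o) 0); apply: eq_bigr => x _.
by rewrite epsZ Eeps mulrC.
Qed.

(* The general element of k[V] (x) k[V], of which the twist [J] is an instance. *)
Definition T (h : V -> V -> k) : AA := \sum_n tn (D (h n)) (E n).

Lemma eq_T h h' : h =2 h' -> T h = T h'.
Proof. by move=> hh; apply: eq_bigr => n _; rewrite (eq_D (hh n)). Qed.

Lemma TM h h' : T h * T h' = T (fun n x => h n x * h' n x).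
Proof.
rewrite mulr_suml; apply: eq_bigr => n _.
rewrite -(sum_delta (fun m => tn (D (fun x => h n x * h' m x)) (E n)) n) mulr_sumr.
apply: eq_bigr => m _; rewrite tnM EM DM eq_sym.
by rewrite tnZr.
Qed.

Lemma T1 : T (fun _ _ => 1) = 1.
Proof. by rewrite /T D1 -tn_sumr E1 tn11. Qed.

Lemma cop_D f : cop (D f) = T (fun n x => f (x + n)).
Proof.
rewrite linear_sum.
under eq_bigr do rewrite linearZ /= Ecop scaler_sumr.
rewrite exchange_big; apply: eq_bigr => n _.
rewrite tn_suml (reindex_inj (addIr n)); apply: eq_bigr => x _.
by rewrite -addrA V2 addr0 tnZl.
Qed.

Lemma T_conj h g h' :
  T h * cop (gd k g) * T h' =
  \sum_y' \sum_y tn (D (h y') * gd k g * D (h' y)) (E y' * gd k g * E y).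
Proof.
rewrite cop_gd !mulr_suml; apply: eq_bigr => y' _.
by rewrite mulr_sumr; apply: eq_bigr => y _; rewrite !tnM.
Qed.

(** The arguments are exchanged because [T] takes the character of the second leg first. *)
Definition J := T (fun n x => W x n).
Definition Ji := T (fun n x => (W x n)^-1).

Lemma JJi : J * Ji = 1.
Proof. by rewrite TM -T1; apply: eq_T => n x; rewrite divff. Qed.
Lemma JiJ : Ji * J = 1.
Proof. by rewrite TM -T1; apply: eq_T => n x; rewrite mulVf. Qed.

Definition DJ (a : A) : AA := Ji * cop a * J.

Lemma DJ_linear : linear DJ.
Proof. by move=> c a b; rewrite /DJ linearP /= mulrDr mulrDl -scalerAr -scalerAl. Qed.
HB.instance Definition _ := GRing.isLinear.Build k A AA _ DJ DJ_linear.

(** This is m(S (x) id)(J): the antipode fixes each [E x], so orthogonality leaves only the diagonal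
    of [W]. *)
Definition v := D (fun x => W x x).
Definition vi := D (fun x => (W x x)^-1).
Lemma vvi : v * vi = 1. Proof. exact: D_inv. Qed.
Lemma viv : vi * v = 1. Proof. exact: D_invl. Qed.

Definition Sj (a : A) : A := vi * antip a * v.

Lemma Sj_linear : linear Sj.
Proof. by move=> c a b; rewrite /Sj linearP /= mulrDr mulrDl -scalerAr -scalerAl. Qed.
HB.instance Definition _ := GRing.isLinear.Build k A A _ Sj Sj_linear.

Lemma SjM a b : Sj (a * b) = Sj b * Sj a.
Proof. by rewrite /Sj antipM -!mulrA (mulrA v) vvi mul1r. Qed.

(** The untwisted antipode is involutive and fixes [v] and [vi], so the two conjugations cancel. *)
Lemma SjK : involutive Sj.
Proof.
move=> a; rewrite /Sj !antipM antip_D [antip vi]antip_D antipK !mulrA viv mul1r.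
by rewrite -!mulrA viv mulr1.
Qed.

Lemma eps_Sj a : eps (Sj a) = eps a.
Proof. by rewrite !epsM mulrAC -epsM viv eps1 mul1r eps_antip. Qed.

Definition L y := D (W^~ y).
Definition Li y := D (fun x => (W x y)^-1).
(* Delta^J(g) is the sum of all theta (x) rho, and Delta^J maps [theta] to
   combinations of theta (x) rho again (the cocycle identity, [DJ_theta]); this
   replaces coassociativity in the antipode identities below. *)
Definition theta g y' y := Li y' * gd k g * L y.
Definition rho g y' y := E y' * gd k g * E y.

Lemma theta00 g : theta g 0 0 = gd k g.
Proof.
rewrite /theta /L /Li (eq_D W_0r) (eq_D (g := fun=> (W 0 0)^-1)); last by move=> x; rewrite W_0r.
by rewrite !D_const -scalerAr -!scalerAl mul1r mulr1 scalerA divff ?scale1r.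
Qed.

Lemma DJ_gd g : DJ (gd k g) = \sum_y' \sum_y tn (theta g y' y) (rho g y' y).
Proof. exact: T_conj. Qed.

Lemma DJ_theta g y' y : DJ (theta g y' y) =
  \sum_n' \sum_n ((W n' y')^-1 * W n y) *: tn (theta g (n' + y') (n + y)) (rho g n' n).
Proof.
rewrite /DJ /theta !cop_mul !mulrA !cop_D TM -mulrA TM T_conj.
apply: eq_bigr => n' _; apply: eq_bigr => n _.
rewrite (eq_D (g := fun x => (W n' y')^-1 * (W x (n' + y'))^-1)); last first.
  by move=> x; rewrite -!invfM Wc.
rewrite [X in _ * _ * X](eq_D (g := fun x => W n y * W x (n + y))); last first.
  by move=> x; rewrite mulrC Wc.
by rewrite !DZ -scalerAr -!scalerAl scalerA tnZl mulrC.
Qed.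

Lemma Sj_rho g y' y :
  Sj (rho g y' y) = ((W y y)^-1 * W y' y') *: (E y * gd k g^-1%g * E y').
Proof.
rewrite /Sj /rho !antipM !ES antip_gd !mulrA D_E -!scalerAl -!mulrA E_D.
by rewrite -!scalerAr scalerA.
Qed.

(** By linearity, an identity on Sweedler sums need only be checked on group elements, where the
    coproduct is the explicit sum of [theta] (x) [rho]. *)
Lemma DJ_lift2 (M : lmodType k) (f : A -> A -> M) (F : A -> M) : linear F ->
  (forall y, linear (f^~ y)) -> (forall x, linear (f x)) ->
  (forall g, \sum_y' \sum_y f (theta g y' y) (rho g y' y) = F (gd k g)) ->
  forall a, lift2 f (DJ a) = F a.
Proof.
move=> linF fl fr fF a; rewrite (linear_expand a linF).
have linG : linear (lift2 f \o DJ) by move=> c x y /=; rewrite !linearP.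
rewrite -[LHS]/((lift2 f \o DJ) a) (linear_expand a linG); apply: eq_bigr => g _ /=.
rewrite -fF DJ_gd; congr (_ *: _); rewrite linear_sum; apply: eq_bigr => y' _.
by rewrite linear_sum; apply: eq_bigr => y _ /=; rewrite lift2_tn.
Qed.

Lemma sum_rho g : \sum_y' \sum_y rho g y' y = gd k g.
Proof.
under eq_bigr do rewrite -mulr_sumr E1 mulr1.
by rewrite -mulr_suml E1 mul1r.
Qed.

Lemma eps_theta g y' y : eps (theta g y' y) = 1.
Proof. by rewrite !epsM !eps_D eps_gd mulr1 !W_0l mulVf. Qed.

Lemma counitl a : lift2 (fun a b => eps a *: b) (DJ a) = a.
Proof.
apply: (DJ_lift2 (F := id)) a => // [y c a b|x c a b|g].
- by rewrite epsD epsZ scalerDl scalerA.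
- by rewrite scalerDr !scalerA mulrC.
rewrite -[RHS]sum_rho; apply: eq_bigr => y' _; apply: eq_bigr => y _.
by rewrite eps_theta scale1r.
Qed.

Lemma counitr a : lift2 (fun a b => eps b *: a) (DJ a) = a.
Proof.
apply: (DJ_lift2 (F := id)) a => // [y c a b|x c a b|g].
- by rewrite scalerDr !scalerA mulrC.
- by rewrite epsD epsZ scalerDl scalerA.
rewrite -[RHS]theta00 -[RHS](sum_delta (theta g 0)) -[RHS](sum_delta (fun z => \sum_y (y == 0)%:R *: theta g z y)).
apply: eq_bigr => y' _; rewrite scaler_sumr; apply: eq_bigr => y _.
by rewrite !epsM !Eeps eps_gd mulr1 scalerA.
Qed.

Lemma Sj_conv a : lift2 (fun a b => Sj b * a) (DJ a) = eps a *: 1.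
Proof.
apply: (DJ_lift2 (F := fun a => eps a *: 1)) a => // [c a b|y c a b|x c a b|g].
- by rewrite epsD epsZ scalerDl scalerA.
- by rewrite mulrDr -scalerAr.
- by rewrite linearP /= mulrDl -scalerAl.
rewrite exchange_big /= eps_gd scale1r -E1; apply: eq_bigr => y _.
(* The diagonal value of [W] produced by [Sj_rho] cancels against [Li y']. The sum over [y'] is then
   free and gives 1, after which [g] meets its inverse. *)
transitivity (\sum_y' (W y y)^-1 *: (E y * gd k g^-1%g * E y' * gd k g * L y)).
  apply: eq_bigr => y' _; rewrite Sj_rho -scalerAl /theta !mulrA -[_ * E y' * Li y']mulrA E_D.
  by rewrite -!scalerAr -!scalerAl scalerA mulfK.
rewrite -scaler_sumr -!mulr_suml -mulr_sumr E1 mulr1 -[_ * gd k g]mulrA gdM mulVg mulr1.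
by rewrite E_D scalerA mulVf ?scale1r.
Qed.

Lemma Sj_counit_r a :
  lift2 (fun a b => DJ a * tn 1 (Sj b)) (DJ a) = tn a 1.
Proof.
apply: (DJ_lift2 (F := fun a => tn a 1)) a => // [c a b|y c a b|x c a b|g].
- exact: tn_linl.
- by rewrite linearP /= mulrDl -scalerAl.
- by rewrite !linearP /= mulrDr -scalerAr.
transitivity (\sum_y' \sum_y \sum_n' ((W n' y')^-1 * W y' y') *:
    tn (theta g (n' + y') 0) (E n' * gd k g * E y * gd k g^-1%g * E y')).
  apply: eq_bigr => y' _; apply: eq_bigr => y _.
  rewrite DJ_theta Sj_rho tnZr -scalerAr mulr_suml scaler_sumr; apply: eq_bigr => n' _.
  rewrite mulr_suml scaler_sumr.
  (* Orthogonality of [E n] and [E y] forces [n = y], so the second index of [theta] becomes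
     [n + y = 0]. *)
  transitivity (\sum_n (n == y)%:R *: (((W n' y')^-1 * W n y * ((W y y)^-1 * W y' y')) *:
    tn (theta g (n' + y') (n + y)) (E n' * gd k g * E n * gd k g^-1%g * E y'))).
    apply: eq_bigr => n _; rewrite -scalerAl tnM mulr1 /rho !mulrA -[_ * E n * E y]mulrA EM.
    by rewrite -!scalerAr -!scalerAl tnZr !scalerA; congr (_ *: _); ring.
  rewrite sum_delta V2; congr (_ *: _).
  by rewrite -mulrA mulVKf.
rewrite -E1 tn_sumr; apply: eq_bigr => y' _; rewrite exchange_big /=.
transitivity (tn (theta g (y' + y') 0) (E y')); last by rewrite V2 theta00.
rewrite -[RHS](sum_delta (fun n' => tn (theta g (n' + y') 0) (E y')) y'); apply: eq_bigr => n' _.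
rewrite -scaler_sumr -tn_sumr -!mulr_suml -mulr_sumr E1 mulr1.
rewrite -[E n' * _ * _]mulrA gdM mulgV mulr1 EM tnZr scalerA mulrC.
by case: eqP => [->|]; rewrite ?mul0r ?scale0r // mul1r mulVf.
Qed.

Definition adJ' x a : A := lift2 (fun b c => b * x * Sj c) (DJ a).

Lemma adJ'_bilinear x c a b : adJ' x (c *: a + b) = c *: adJ' x a + adJ' x b.
Proof. by rewrite /adJ' !linearP. Qed.

Lemma adJ'_mul x a : lift2 (fun b c => adJ' x b * c) (DJ a) = a * x.
Proof.
apply: (DJ_lift2 (F := fun a => a * x)) a => // [c a b|y c a b|z c a b|g].
- by rewrite mulrDl -scalerAl.
- by rewrite adJ'_bilinear mulrDl -scalerAl.
- by rewrite mulrDr -scalerAr.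
have adth y' y : adJ' x (theta g y' y) = \sum_n' \sum_n ((W n' y')^-1 * W n y) *:
    (theta g (n' + y') (n + y) * x * Sj (rho g n' n)).
  rewrite /adJ' DJ_theta linear_sum; apply: eq_bigr => n' _.
  rewrite linear_sum; apply: eq_bigr => n _; rewrite linearZ /= lift2_tn // => [z c a b|z c a b].
    by rewrite !mulrDl -!scalerAl.
  by rewrite linearP /= mulrDr -scalerAr.
(* Orthogonality of [E n'] and [E y'] forces [n' = y']. Summing over [y'] will then cancel [g] with
   its inverse and force [n = y], leaving [theta g 0 0]. *)
transitivity (\sum_y' \sum_y \sum_n (W n y / W n n) *: 
   (theta g 0 (n + y) * x * (E n * gd k g^-1%g * E y' * gd k g * E y))).
  apply: eq_bigr => y' _; apply: eq_bigr => y _; rewrite adth mulr_suml.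
  under eq_bigr do rewrite mulr_suml.
  rewrite exchange_big; apply: eq_bigr => n _.
  transitivity (\sum_n' (n' == y')%:R *: ((W n' y')^-1 * W n y * ((W n n)^-1 * W n' n') *:
     (theta g (n' + y') (n + y) * x * (E n * gd k g^-1%g * E y' * gd k g * E y)))).
    apply: eq_bigr => n' _; rewrite Sj_rho -!scalerAr -!scalerAl scalerA.
    rewrite /rho !mulrA -[_ * E n' * E y']mulrA EM.
    case: eqP => [->|_]; last by rewrite !scale0r mulr0 !mul0r !scaler0.
    by rewrite !scale1r; congr (_ *: _); ring.
  rewrite sum_delta V2; congr (_ *: _).
  by field; rewrite !W0.
rewrite exchange_big /=.
transitivity (\sum_y gd k g * x * E y); last by rewrite -mulr_sumr E1 mulr1.
apply: eq_bigr => y _; rewrite exchange_big /=.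
transitivity (\sum_n (n == y)%:R *: ((W n y / W n n) *: (theta g 0 (n + y) * x * E n))).
  apply: eq_bigr => n _; rewrite -scaler_sumr -mulr_sumr -!mulr_suml -mulr_sumr E1 mulr1.
  rewrite -[E n * _ * _]mulrA gdM mulVg mulr1 EM -scalerAr !scalerA mulrC.
  by [].
by rewrite sum_delta V2 divff // scale1r theta00.
Qed.

Lemma eps2_DJ a : lift2 (fun b c => eps b * eps c : k^o) (DJ a) = eps a.
Proof.
apply: (DJ_lift2 (F := fun a => eps a : k^o)) a => // [c a b|y c a b|z c a b|g].
- exact: eps_linear.
- by rewrite epsD epsZ mulrDl -mulrA.
- by rewrite epsD epsZ mulrDr mulrCA.
transitivity (eps (\sum_y' \sum_y rho g y' y)); last by rewrite sum_rho.
rewrite eps_sum; apply: eq_bigr => y' _; rewrite eps_sum; apply: eq_bigr => y _.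
by move=> /=; rewrite -[RHS]mul1r -(eps_theta g y' y).
Qed.

Lemma eps_adJ' x a : eps (adJ' x a) = eps a * eps x.
Proof.
rewrite -(eps2_DJ a) /lift2 mulr_suml eps_sum; apply: eq_bigr => p _.
by rewrite epsZ epsM epsM eps_Sj mulrAC mulrA.
Qed.

(* Slicing a tensor with [cf c d g] isolates the right (or left) leg lying in the
   corner e_c kG e_d. *)
Definition cf c d g (a : A) : k := (E c * a * E d) g.

Lemma cf_linear c d g : linear (cf c d g : A -> k^o).
Proof.
by move=> a u w; rewrite /cf mulrDr mulrDl ga_addE -scalerAr -scalerAl ga_scaleE.
Qed.
HB.instance Definition _ c d g :=
  GRing.isLinear.Build k A k^o _ (cf c d g : A -> k^o) (@cf_linear c d g).

Lemma cf_E c d g x a y :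
  cf c d g (E x * a * E y) = (x == c)%:R * ((y == d)%:R * cf c d g a).
Proof.
rewrite /cf !mulrA EM -[_ * E y * E d]mulrA EM -scalerAr -!scalerAl !ga_scaleE.
by rewrite [x == c]eq_sym; case: (y =P d) => [->|_]; rewrite ?(mulr1, mul1r, mulr0, mul0r).
Qed.

Lemma slr_T c d g h x h' : slr (cf c d g) (T h * cop (gd k x) * T h') =
  cf c d g (gd k x) *: (D (h c) * gd k x * D (h' d)).
Proof.
rewrite T_conj -[RHS](sum_delta (fun y' => cf c d g (gd k x) *: (D (h y') * gd k x * D (h' d)))).
rewrite linear_sum; apply: eq_bigr => y' _.
rewrite -(sum_delta (fun y => cf c d g (gd k x) *: (D (h y') * gd k x * D (h' y)))).
rewrite (linear_sum (slr (cf c d g))) scaler_sumr; apply: eq_bigr => y _.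
by rewrite /= slr_tn /= cf_E !scalerA mulrA.
Qed.

Lemma T_flip h : T h = \sum_x tn (E x) (D (h^~ x)).
Proof.
transitivity (\sum_n \sum_x h n x *: tn (E x) (E n)).
  by apply: eq_bigr => n _; rewrite tn_suml; apply: eq_bigr => x _; rewrite tnZl.
rewrite exchange_big; apply: eq_bigr => x _.
by rewrite tn_sumr; apply: eq_bigr => y _; rewrite tnZr.
Qed.

Lemma T_conj_flip h g h' : T h * cop (gd k g) * T h' =
  \sum_y' \sum_y tn (E y' * gd k g * E y) (D (h^~ y') * gd k g * D (h'^~ y)).
Proof.
rewrite !T_flip cop_gd !mulr_suml; apply: eq_bigr => y' _.
by rewrite mulr_sumr; apply: eq_bigr => y _; rewrite !tnM.
Qed.

Lemma sll_T c d g h x h' : sll (cf c d g) (T h * cop (gd k x) * T h') =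
  cf c d g (gd k x) *: (D (h^~ c) * gd k x * D (h'^~ d)).
Proof.
rewrite T_conj_flip -[RHS](sum_delta (fun y' => cf c d g (gd k x) *: (D (h^~ y') * gd k x * D (h'^~ d)))).
rewrite linear_sum; apply: eq_bigr => y' _.
rewrite -(sum_delta (fun y => cf c d g (gd k x) *: (D (h^~ y') * gd k x * D (h'^~ y)))).
rewrite (linear_sum (sll (cf c d g))) scaler_sumr; apply: eq_bigr => y _.
by rewrite /= sll_tn /= cf_E !scalerA mulrA.
Qed.

Lemma E_gd_E c x d : E c * gd k x * E d =
  (q^-1 * q^-1) *: \sum_z \sum_z' (s c z * s d z') *: gd k (eta z * x * eta z')%g.
Proof.
rewrite !EE -!scalerAl -scalerAr scalerA; congr (_ *: _); rewrite !mulr_suml.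
apply: eq_bigr => z _; rewrite mulr_sumr; apply: eq_bigr => z' _.
by rewrite -!scalerAl -scalerAr scalerA !gdM.
Qed.

Lemma cf_gd c d g x : cf c d g (gd k x) =
  q^-1 * q^-1 * \sum_z \sum_z' s c z * s d z' * (x == eta z * g * eta z')%g%:R.
Proof.
rewrite /cf E_gd_E ga_scaleE; congr (_ * _).
rewrite ga_sumE; apply: eq_bigr => z _; rewrite ga_sumE; apply: eq_bigr => z' _.
rewrite ga_scaleE gdE; congr (_ * _%:R); congr nat_of_bool.
by apply/eqP/eqP => ->; rewrite !mulgA -etaD V2 eta0 mul1g -!mulgA -etaD V2 eta0 mulg1.
Qed.

(** * Slices of the coproduct of a character sum *)

Section CharacterSum.
Variables (psi : gT -> k) (t : V).
Hypothesis psiM : forall g h, psi (g * h)%g = psi g * psi h.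
Hypothesis psi_eta : forall z, psi (eta z) = s t z.

(** [psi] is multiplicative and restricts on H to the character [t], so weighting by [psi] shifts
    both idempotents of the corner by [t]. *)
Lemma cf_sum c d g : \sum_x (psi x * cf c d g (gd k x)) *: gd k x =
  psi g *: (E (c + t) * gd k g * E (d + t)).
Proof.
rewrite E_gd_E scalerA [psi g * _]mulrC -scalerA.
transitivity ((q^-1 * q^-1) *: \sum_x \sum_z \sum_z'
   (x == eta z * g * eta z')%g%:R *: ((psi x * s c z * s d z') *: gd k x)).
  rewrite scaler_sumr; apply: eq_bigr => x _; rewrite cf_gd mulrCA -[LHS]scalerA; congr (_ *: _).
  rewrite mulr_sumr scaler_suml; apply: eq_bigr => z _.
  rewrite mulr_sumr scaler_suml; apply: eq_bigr => z' _.
  by rewrite scalerA; congr (_ *: _); ring.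
congr (_ *: _).
rewrite exchange_big scaler_sumr; apply: eq_bigr => z _.
rewrite exchange_big scaler_sumr; apply: eq_bigr => z' _.
rewrite (bigD1 (eta z * g * eta z')%g) //= eqxx scale1r big1 ?addr0 => [|x /negPf->]; last by rewrite scale0r.
by rewrite scalerA !psiM !psi_eta !sDl; congr (_ *: _); ring.
Qed.

Lemma slr_DJ_sum c d g :
  slr (cf c d g) (DJ (\sum_x psi x *: gd k x)) =
  (psi g * (W (c + t) c)^-1 * W (d + t) d) *: (E (c + t) * gd k g * E (d + t)).
Proof.
rewrite (linear_sum DJ) (linear_sum (slr (cf c d g))).
transitivity (Li c * (\sum_x (psi x * cf c d g (gd k x)) *: gd k x) * L d).
  rewrite [X in X * _]mulr_sumr mulr_suml; apply: eq_bigr => x _.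
  rewrite linearZ linearZ -scalerAr -scalerAl -scalerA; congr (_ *: _).
  exact: slr_T.
rewrite cf_sum -scalerAr -scalerAl !mulrA D_E -!mulrA E_D -!scalerAr -!scalerAl.
by rewrite -?scalerAr !scalerA; congr (_ *: _); ring.
Qed.

(** The corner is that of [slr_DJ_sum], but each value of [W] has its arguments exchanged; comparing
    the two detects asymmetry of the cocycle. *)
Lemma sll_DJ_sum c d g :
  sll (cf c d g) (DJ (\sum_x psi x *: gd k x)) =
  (psi g * (W c (c + t))^-1 * W d (d + t)) *: (E (c + t) * gd k g * E (d + t)).
Proof.
rewrite (linear_sum DJ) (linear_sum (sll (cf c d g))).
transitivity (D (fun y => (W c y)^-1) * (\sum_x (psi x * cf c d g (gd k x)) *: gd k x) * D (W d)).
  rewrite [X in X * _]mulr_sumr mulr_suml; apply: eq_bigr => x _.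
  rewrite linearZ linearZ -scalerAr -scalerAl -scalerA; congr (_ *: _).
  exact: sll_T.
rewrite cf_sum -scalerAr -scalerAl !mulrA D_E -!mulrA E_D -!scalerAr -!scalerAl.
by rewrite -?scalerAr !scalerA; congr (_ *: _); ring.
Qed.
End CharacterSum.

(** Slicing moves one corner of [g] to any other corner, up to a scalar that vanishes only with
    [cf c d g (gd k g)]. *)
Lemma slr_DJ_E c d g x y :
  slr (cf c d g) (DJ (E x * gd k g * E y)) =
  (cf c d g (gd k g) * (W (x + c) c)^-1 * W (y + d) d) *: (E (x + c) * gd k g * E (y + d)).
Proof.
have copE z : cop (E z) = T (fun n w => (w + n == z)%:R).
  have {1}-> : E z = D (fun w => (w == z)%:R) by rewrite -[LHS](sum_delta E z).
  exact: cop_D.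
rewrite /DJ !cop_mul !copE !mulrA TM -mulrA TM slr_T -!scalerA; congr (_ *: _).
have Dd (f : V -> k) n z : D (fun w => (w + n == z)%:R * f w) = f (z + n) *: E (z + n).
  rewrite -(sum_delta (fun w => f w *: E w) (z + n)); apply: eq_bigr => w _.
  by rewrite scalerA -(inj_eq (addIr n) w) -addrA V2 addr0.
rewrite Dd (eq_D (g := fun w => (w + c == x)%:R * (W w c)^-1)) => [|w]; last exact: mulrC.
by rewrite Dd -scalerAr -!scalerAl scalerA mulrC -scalerA.
Qed.

(** * Consequences for a normal Hopf subalgebra *)

Section NormalHopfSubalgebra.
Variable B : A -> Prop.
Hypothesis k0 : [pchar k] =i pred0.
Hypothesis B0 : B 0.
Hypothesis BP : forall c a b, B a -> B b -> B (c *: a + b).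
Hypothesis B1 : B 1.
Hypothesis BM : forall a b, B a -> B b -> B (a * b).
Hypothesis BDelta : forall a, B a -> tensor_sub B (DJ a).
Hypothesis BS : forall a, B a -> B (Sj a).
Hypothesis Bad : forall x a, B x -> B (adJ' x a).

Lemma twisted_integral_subgroup : exists N : {group gT}, [/\ (N <| [set: gT])%g,
  B (\sum_(g in N) gd k g)
  & forall x, B x -> x * (\sum_(g in N) gd k g) = eps x *: (\sum_(g in N) gd k g)].
Proof.
apply: (hopf_integral_subgroup (F := J) (Fi := Ji) (Delta := DJ) (S := Sj)) => //.
- exact: JJi.
- exact: SjM.
- exact: SjK.
- exact: eps_Sj.
- exact: counitl.
- exact: counitr.
- exact: Sj_conv.
- exact: Sj_counit_r.
- exact: adJ'_mul.
- exact: eps_adJ'.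
Qed.

Let BZr c a : c != 0 -> B (c *: a) -> B a.
Proof. by move=> c0 /(BZ B0 BP c^-1); rewrite scalerA mulVf ?scale1r. Qed.

Lemma full_of_corners : (forall c d g, B (E c * gd k g * E d)) -> forall x, B x.
Proof.
move=> BE x; rewrite [x]ga_expand; apply: B_sum => // g _; apply: (BZ B0 BP).
rewrite -sum_rho; apply: B_sum => // y' _; apply: B_sum => // y _; exact: BE.
Qed.

(** The trivial character, with [t = 0], makes every slice of the coproduct a nonzero multiple of a
    corner. *)
Lemma full_of_total_sum : B (\sum_g gd k g) -> forall x, B x.
Proof.
move=> BT; apply: full_of_corners => c d g.
have {}BT : B (\sum_g 1 *: gd k g) by under eq_bigr do rewrite scale1r.
have := tensor_sub_slr B0 BP (cf c d g) (BDelta BT).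
rewrite (slr_DJ_sum (psi := fun=> 1) (t := 0)) => [|_ _|z]; last 2 first.
- by rewrite mulr1.
- by rewrite s0l.
rewrite !addr0; apply: BZr.
by rewrite mul1r mulf_neq0 ?invr_eq0.
Qed.

Section IndexTwo.
Variables (psi : gT -> k) (t p : V).
Hypothesis psiM : forall g h, psi (g * h)%g = psi g * psi h.
Hypothesis psi_eta : forall z, psi (eta z) = s t z.
Hypothesis psi_sign : forall g, psi g = 1 \/ psi g = -1.
Hypothesis W_asym : W (p + t) p != W p (p + t).
Hypothesis BK : B (\sum_(g | psi g == 1) gd k g).

(** Twice the kernel sum is the sum for the trivial character plus the sum for [psi]. Subtracting
    the left slice from the right one at [(0, p)] cancels the trivial part, while the [psi] part
    survives by [W_asym]. *)
Lemma corner_of_kernel_sum g : B (E t * gd k g * E (p + t)).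
Proof.
pose T1 : A := \sum_g 1 *: gd k g; pose T2 : A := \sum_g psi g *: gd k g.
have BT : B (T1 + T2).
  have -> : T1 + T2 = 2 *: \sum_(g | psi g == 1) gd k g.
    rewrite /T1 /T2 -big_split scaler_sumr [RHS]big_mkcond; apply: eq_bigr => x _ /=.
    case: (psi_sign x) => ->; first by rewrite eqxx -scalerDl.
    have /negPf-> : -1 != 1 :> k by rewrite eq_sym -subr_eq0 opprK -mulr2n; have /pcharf0P-> := k0.
    by rewrite -scalerDl subrr scale0r.
  exact: BZ.
have DT := BDelta BT.
have BR := tensor_sub_slr B0 BP (cf 0 p g) DT.
have BL := tensor_sub_sll B0 BP (cf 0 p g) DT.
move: (BP (-1) BL BR).
have oneM (g1 g2 : gT) : 1 = 1 * 1 :> k by rewrite mulr1.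
have one_eta z : 1 = s 0 z by rewrite s0l.
rewrite (linearD DJ) (linearD (slr (cf 0 p g))) (linearD (sll (cf 0 p g))) /=.
rewrite (slr_DJ_sum oneM one_eta) (sll_DJ_sum oneM one_eta).
rewrite (slr_DJ_sum psiM psi_eta) (sll_DJ_sum psiM psi_eta) !addr0 !add0r W_0l W_0r.
rewrite scaleN1r opprD addrACA addNr add0r -scaleNr -scalerDl; apply: BZr.
rewrite -mulrN -mulrDr !mulf_neq0 ?invr_eq0 //.
  by case: (psi_sign g) => ->; rewrite ?oppr_eq0 oner_eq0.
by rewrite addrC subr_eq0.
Qed.

End IndexTwo.

(** The hypothesis says that the double coset HgH has the maximal number of elements. All
    coefficients [cf c d g (gd k g)] are then nonzero, so one corner yields every corner of [g], and
    these span all of HgH. *)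
Lemma gd_of_corner x y g : (forall z z', (eta z * g * eta z')%g = g -> z = 0 /\ z' = 0) ->
  B (E x * gd k g * E y) -> forall z, B (gd k (eta z * g)%g).
Proof.
move=> freeg BE z.
have cf0 c d : cf c d g (gd k g) != 0.
  have -> : cf c d g (gd k g) = q^-1 * q^-1; last by rewrite mulf_neq0 ?invr_eq0.
  rewrite cf_gd -[RHS]mulr1; congr (_ * _).
  rewrite (bigD1 0) //= (bigD1 0) //= eta0 mul1g mulg1 eqxx !s0r !mul1r.
  rewrite !big1 ?addr0 // => z1 z10.
    rewrite big1 // => z2 _; case: eqP => [gE|_]; last by rewrite mulr0.
    by have [z1E _] := freeg _ _ (esym gE); rewrite z1E eqxx in z10.
  case: eqP => [gE|_]; last by rewrite mulr0.
  have [|_ z1E] := freeg 0 z1; first by rewrite eta0 mul1g.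
  by rewrite z1E eqxx in z10.
have BEE a b : B (E a * gd k g * E b).
  (* The slice is chosen so that the shift carries the corner [(x, y)] to [(a, b)]. *)
  have := tensor_sub_slr B0 BP (cf (x + a) (y + b) g) (BDelta BE).
  rewrite slr_DJ_E !addrA !V2 !add0r; apply: BZr.
  by rewrite !mulf_neq0 ?invr_eq0.
rewrite -gdM -[gd k (eta z)]mulr1 -E1 mulr_sumr mulr_suml; apply: B_sum => // a _.
rewrite gd_E -scalerAl -[gd k g]mulr1 -E1 !mulr_sumr; apply: (BZ B0 BP).
by apply: B_sum => // b _; rewrite mulrA.
Qed.

End NormalHopfSubalgebra.

(** * Identification with the given twisted structure, and the simplicity criterion *)

Lemma tinvJ : tinv J = Ji. Proof. exact: tinvE JJi JiJ. Qed.

Lemma DeltaJE a : DeltaJ J a = DJ a.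
Proof. by rewrite /DeltaJ tinvJ !tmulE mulrA. Qed.

Lemma twist_vJ : twist_v J = v.
Proof.
rewrite twist_vE linear_sum; apply: eq_bigr => n _ /=.
rewrite lift2_tn => [|y c a b|x c a b].
- by rewrite antip_D D_E.
- by rewrite linearP /= mulrDl -scalerAl.
- by rewrite mulrDr -scalerAr.
Qed.

Lemma SJE a : SJ J a = Sj a.
Proof.
rewrite /SJ twist_vJ (ginvE vvi viv) /Sj -mulrA //.
Qed.

Lemma adJE h x : adJ J h x = adJ' x h.
Proof. by apply: eq_bigr => p _; rewrite gscaleE DeltaJE SJE. Qed.

Theorem twisted_simple_J (psi : gT -> k) (t p : V) (g0 : gT) :
  [pchar k] =i pred0 ->
  (forall g h, psi (g * h)%g = psi g * psi h) -> (forall z, psi (eta z) = s t z) ->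
  (forall g, psi g = 1 \/ psi g = -1) -> (exists z, psi (eta z) != 1) ->
  W (p + t) p != W p (p + t) ->
  (forall z z', (eta z * g0 * eta z')%g = g0 -> z = 0 /\ z' = 0) ->
  (forall N : {group gT}, (N <| [set: gT])%g ->
    [\/ N :=: 1%g, N :=: [set: gT] | N :=: [set g | psi g == 1]]) ->
  twisted_simple J.
Proof.
move=> k0 psiM psi_eta psi_sign [z0 psi_z0] Wasym freeg normalG B [[[B0 [BD BZ']] B1 BM BDelta BS] Bad].
have {BZ'}BP (c : k) (a b : A) : B a -> B b -> B (c *: a + b).
  by move=> Ba Bb; rewrite -gscaleE; apply: BD => //; apply: BZ'.
have {}BDelta a : B a -> tensor_sub B (DJ a) by rewrite -DeltaJE; apply: BDelta.
have {}BS a : B a -> B (Sj a) by rewrite -SJE; apply: BS.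
have {}Bad x a : B x -> B (adJ' x a) by rewrite -adJE; apply: Bad.
have [N [normN BN xN]] := twisted_integral_subgroup k0 B0 BP B1 BM BDelta BS Bad.
have mem_N g : B (gd k g) -> g \in N by move=> /xN; apply: gd_in_stabilizer.
have [N1|NG|Npsi] := normalG N normN.
- left=> x; split=> [/xN|[c ->]].
    rewrite N1 big_set1 mulr1 => xE; exists (eps x); rewrite gscaleE; exact: xE.
  rewrite gscaleE -[c *: _]addr0; apply: BP => //; exact: B1.
- right; apply: (full_of_total_sum B0 BP BDelta).
  move: BN; rewrite NG; congr B; apply: eq_bigl => g; exact: in_setT.
exfalso.
have BK : B (\sum_(g | psi g == 1) gd k g).
  by move: BN; rewrite Npsi; congr B; apply: eq_bigl => g; rewrite inE.
have Bcor := corner_of_kernel_sum k0 B0 BP BDelta psiM psi_eta psi_sign Wasym BK g0.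
(* All of [eta z * g0] lie in the kernel of [psi]; comparing [z = 0] with [z = z0] contradicts the
   nontriviality of [psi] on H. *)
have Bgd z : psi (eta z * g0)%g = 1.
  by have /mem_N := gd_of_corner B0 BP BDelta freeg Bcor z; rewrite Npsi inE => /eqP.
have psi_g0 : psi g0 = 1 by rewrite -(Bgd 0) eta0 mul1g.
by move/eqP: psi_z0; apply; rewrite -(Bgd z0) psiM psi_g0 mulr1.
Qed.

End Twist.

(** * The subgroup generated by two disjoint transpositions *)

HB.instance Definition _ (U1 U2 : finZmodType) := Finite.on (U1 * U2)%type.

Section Klein.
Variable k : fieldType.
Hypothesis k2 : 2 != 0 :> k.
Local Notation V := ('Z_2 * 'Z_2)%type.

Definition sg (u : 'Z_2) : k := (-1) ^+ u.
Definition pairing (x z : V) : k := sg (x.1 * z.1) * sg (x.2 * z.2).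

Lemma Z2P (P : 'Z_2 -> Prop) : P 0 -> P 1 -> forall u, P u.
Proof.
move=> P0 P1 [[|[|//]] u2].
  by rewrite (_ : Ordinal _ = 0) //; apply: val_inj.
by rewrite (_ : Ordinal _ = 1) //; apply: val_inj.
Qed.

Lemma sgD u w : sg (u + w) = sg u * sg w.
Proof. by rewrite /sg -exprD -[RHS]signr_odd /= modn2. Qed.

Lemma V2 (x : V) : x + x = 0.
Proof. by case: x => x y; congr pair; [move: x | move: y]; apply: Z2P; apply: val_inj. Qed.

Lemma pairingDl x y z : pairing (x + y) z = pairing x z * pairing y z.
Proof. by rewrite /pairing !mulrDl !sgD mulrACA. Qed.

Lemma pairingC x z : pairing x z = pairing z x.
Proof. by rewrite /pairing mulrC [z.2 * _]mulrC [z.1 * _]mulrC [RHS]mulrC. Qed.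

Lemma pairingDr x y z : pairing x (y + z) = pairing x y * pairing x z.
Proof. by rewrite !(pairingC x) pairingDl. Qed.

Lemma pairing0l z : pairing 0 z = 1.
Proof. by rewrite /pairing !mul0r mulr1. Qed.

Lemma pairing0r x : pairing x 0 = 1.
Proof. by rewrite pairingC pairing0l. Qed.

Lemma cardV : #|{: V}|%:R = 4 :> k.
Proof. by rewrite card_prod card_ord. Qed.

Lemma cardV_neq0 : #|{: V}|%:R != 0 :> k.
Proof. by rewrite cardV (natrM _ 2 2) mulf_neq0. Qed.

Lemma neg1_neq1 : -1 != 1 :> k.
Proof. by rewrite eq_sym -subr_eq0 opprK. Qed.

Lemma sum_sg (w : 'Z_2) : \sum_u sg (u * w) = (w == 0)%:R * 2.
Proof.
rewrite big_ord_recl big_ord1 /=; move: w; apply: Z2P.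
  by rewrite !mulr0 mul1r.
by rewrite !mulr1 mul0r; exact: addrN.
Qed.

Lemma sum_pairing z : \sum_x pairing x z = (z == 0)%:R * #|{: V}|%:R.
Proof.
transitivity (\sum_(u : 'Z_2) \sum_(w : 'Z_2) sg (u * z.1) * sg (w * z.2)).
  by rewrite pair_bigA.
under eq_bigr do rewrite -mulr_sumr.
rewrite -mulr_suml !sum_sg cardV mulrACA -(natrM _ (z.1 == 0)) mulnb -(natrM _ 2 2).
by case: z.
Qed.

Lemma sum_pairingr x : \sum_z pairing x z = (x == 0)%:R * #|{: V}|%:R.
Proof. by rewrite -sum_pairing; apply: eq_bigr => z _; rewrite pairingC. Qed.

Variables (gT : finGroupType) (a b : gT).
Hypothesis aa : (a * a)%g = 1%g.
Hypothesis bb : (b * b)%g = 1%g.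
Hypothesis ab : commute a b.
Hypothesis a1 : a != 1%g.
Hypothesis b1 : b != 1%g.
Hypothesis ab1 : a != b.

Definition klein (z : V) : gT := (a ^+ z.1 * b ^+ z.2)%g.

Lemma expg_Z2D (x : gT) (i j : 'Z_2) : (x * x)%g = 1%g -> (x ^+ (i + j)%R)%g = (x ^+ i * x ^+ j)%g.
Proof. by move=> xx; rewrite -expgD /= expg_mod. Qed.

Lemma kleinD x y : klein (x + y) = (klein x * klein y)%g.
Proof.
rewrite /klein /= !expg_Z2D // -!mulgA; congr (_ * _)%g; rewrite !mulgA; congr (_ * _)%g.
by apply: commuteX2.
Qed.

Lemma klein_inj : injective klein.
Proof.
have k1 z : klein z = 1%g -> z = 0.
  case: z => i j; rewrite /klein /=; move: i j; apply: Z2P; apply: Z2P => //=.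
  - by rewrite mul1g expg1 => /eqP; rewrite (negPf b1).
  - by rewrite mulg1 expg1 => /eqP; rewrite (negPf a1).
  - rewrite !expg1 => ab1'; case/eqP: ab1.
    by rewrite -[a]mulg1 -bb mulgA ab1' mul1g.
move=> x y xy; apply/eqP; rewrite -(inj_eq (addIr y)) V2; apply/eqP/k1.
by rewrite kleinD xy -kleinD V2 /klein mulg1.
Qed.

Local Notation H := (<<[set a; b]>>%G).

Lemma mem_kleinP g : reflect (exists z, g = klein z) (g \in H).
Proof.
have gH : group_set [set klein z | z : V].
  apply/group_setP; split=> [|_ _ /imsetP[x _ ->] /imsetP[y _ ->]].
    by apply/imsetP; exists 0; rewrite // /klein mulg1.
  by rewrite -kleinD imset_f.
have -> : H = Group gH.
  apply/val_inj/eqP; rewrite eqEsubset; apply/andP; split.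
    rewrite gen_subG; apply/subsetP => x /set2P[]->; apply/imsetP.
      by exists (1, 0); rewrite // /klein mulg1 expg1.
    by exists (0, 1); rewrite // /klein mul1g expg1.
  apply/subsetP => _ /imsetP[z _ ->]; rewrite groupM ?groupX // mem_gen // !inE eqxx ?orbT //.
by apply: (iffP imsetP) => [[z _ ->]|[z ->]]; exists z.
Qed.

Definition kchar (x : V) : galg gT k := [ffun g => \sum_z pairing x z * (g == klein z)%:R].

Lemma kchar_klein x z : kchar x (klein z) = pairing x z.
Proof.
rewrite ffunE (bigD1 z) //= eqxx mulr1 big1 ?addr0 // => y yz.
by rewrite (inj_eq klein_inj) eq_sym (negPf yz) mulr0.
Qed.

Lemma kchar_out x g : g \notin H -> kchar x g = 0.
Proof.
move=> gH; rewrite ffunE big1 // => z _; case: eqP => [gz|]; last by rewrite mulr0.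
by case/mem_kleinP: gH; exists z.
Qed.

Lemma kchar_inj : injective kchar.
Proof.
move=> x y xy; have pxy z : pairing x z = pairing y z by rewrite -!kchar_klein xy.
have sginj (u w : 'Z_2) : sg u = sg w -> u = w.
  move: u w; apply: Z2P; apply: Z2P => //; rewrite /sg /= expr1 expr0 => /eqP.
    by rewrite eq_sym (negPf neg1_neq1).
  by rewrite (negPf neg1_neq1).
case: x y pxy {xy} => [x1 x2] [y1 y2] pxy; congr pair; apply: sginj.
  by have := pxy (1, 0); rewrite /pairing /= !mulr1 !mulr0 !mulr1.
by have := pxy (0, 1); rewrite /pairing /= !mulr1 !mulr0 !mul1r.
Qed.

Lemma kchar_mul x y : char_mul (kchar x) (kchar y) = kchar (x + y).
Proof.
apply/ffunP=> g; rewrite [LHS]ffunE; case: (boolP (g \in H)) => [/mem_kleinP[z ->]|gH].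
  by rewrite !kchar_klein pairingDl.
by rewrite !kchar_out // mulr0.
Qed.

(** A character is determined by its values on [a] and [b]. Each squares to 1, hence is a sign, and
    the two signs are the coordinates of [x]. *)
Lemma is_hcharP (c : galg gT k) : is_hchar H c <-> exists x, c = kchar x.
Proof.
split=> [[cout cn0 cM]|[x ->]]; last first.
  split=> [g|g /mem_kleinP[z ->]|g h /mem_kleinP[z ->] /mem_kleinP[y ->]].
  - exact: kchar_out.
  - by rewrite kchar_klein mulf_neq0 // signr_eq0.
  - by rewrite -kleinD !kchar_klein pairingDr.
have aH : a \in H by rewrite mem_gen // !inE eqxx.
have bH : b \in H by rewrite mem_gen // !inE eqxx orbT.
have c1 : c 1%g = 1.
  by apply: (mulfI (cn0 _ (group1 H))); rewrite -cM // mulr1 mulg1.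
have sgE g : g \in H -> (g * g)%g = 1%g -> exists u : 'Z_2, forall i : 'Z_2, c (g ^+ i)%g = sg (u * i).
  move=> gH gg; have /eqP : c g ^+ 2 = 1 by rewrite expr2 -cM // gg.
  rewrite sqrf_eq1 => /orP[]/eqP cg; [exists 0 | exists 1].
    by apply: Z2P; rewrite ?mul0r ?expg0 ?expg1.
  by apply: Z2P; rewrite ?mul1r ?expg0 ?expg1.
have [u cu] := sgE _ aH aa; have [w cw] := sgE _ bH bb.
exists (u, w); apply/ffunP=> g; case: (boolP (g \in H)) => [/mem_kleinP[z ->]|gH].
  by rewrite kchar_klein cM ?groupX // cu cw.
by rewrite kchar_out ?cout.
Qed.

Lemma card_klein : #|H| = 4.
Proof.
have -> : H = [set klein z | z : V] :> {set gT}.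
  apply/setP=> g; apply/mem_kleinP/imsetP => [[z ->]|[z _ ->]]; by exists z.
by rewrite card_imset ?card_prod ?card_ord //; exact: klein_inj.
Qed.

Lemma e_chi_kchar x : e_chi H (kchar x) = E klein pairing x.
Proof.
apply/ffunP=> g; rewrite EE ga_scaleE cardV [LHS]ffunE card_klein.
have -> : (\sum_z pairing x z *: gd k (klein z)) g = kchar x g.
  rewrite ga_sumE [RHS]ffunE; apply: eq_bigr => z _; by rewrite ga_scaleE gdE.
case: (boolP (g \in H)) => [/mem_kleinP[z ->]|gH]; last by rewrite kchar_out ?mulr0.
by rewrite (etaV V2 kleinD).
Qed.

(** Any enumeration of the characters is a permutation of the list of all [kchar x], and the double
    sum does not depend on the order. *)
Lemma twistJ_kchar (s : seq (galg gT k)) w : enumerates_chars H s ->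
  twistJ H s w = J klein pairing (fun x y => w (kchar x) (kchar y)).
Proof.
move=> [us ms].
have ps : perm_eq s (map kchar (index_enum V)).
  apply: uniq_perm => //; first by rewrite map_inj_uniq ?index_enum_uniq //; exact: kchar_inj.
  move=> c; apply/idP/mapP => [/ms/is_hcharP[x ->]|[x _ ->]].
    by exists x; rewrite ?mem_index_enum.
  by apply/ms/is_hcharP; exists x.
rewrite /twistJ (perm_big _ ps) big_map.
under eq_bigr do rewrite (perm_big _ ps) big_map.
rewrite exchange_big; apply: eq_bigr => y _; rewrite tn_suml; apply: eq_bigr => x _.
by rewrite tscaleE tnZl !e_chi_kchar.
Qed.
End Klein.

(** * Symmetric cocycles on the Klein four-group are coboundaries *)

Section KleinCocycle.
Variables (k : closedFieldType) (k2 : 2 != 0 :> k) (gT : finGroupType) (a b : gT).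
Local Notation V := ('Z_2 * 'Z_2)%type.
Hypotheses (aa : (a * a)%g = 1%g) (bb : (b * b)%g = 1%g) (ab : commute a b).
Hypotheses (a1 : a != 1%g) (b1 : b != 1%g) (ab1 : a != b).
Local Notation H := (<<[set a; b]>>%G).
Variable w : galg gT k -> galg gT k -> k.
Local Notation W := (fun x y : V => w (kchar k a b x) (kchar k a b y)).

Let kH x : is_hchar H (kchar k a b x).
Proof. by apply/(is_hcharP aa bb ab a1 b1 ab1); exists x. Qed.

Lemma closed_sqrt (x : k) : exists y, y ^+ 2 = x.
Proof.
(* The monic equation is y^2 = x + 0 y. *)
have [y yE] := @solve_monicpoly k 2 (fun i => if i == 0%N then x else 0) isT.
by exists y; rewrite yE big_ord_recl big_ord1 /= mul0r addr0 mulr1.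
Qed.

Lemma klein_ind (P : V -> Prop) :
  P 0 -> P (1, 0) -> P (0, 1) -> P ((1, 0) + (0, 1)) -> forall x, P x.
Proof.
move=> P0 Pp Pq Ppq [i j]; move: i j; apply: Z2P; apply: Z2P => //.
by move: Ppq; congr P; congr pair; rewrite /= ?addr0 ?add0r.
Qed.

(** Under symmetry, the cocycle identity determines all of [W] from its values at [(0,0)], [(p,p)],
    [(q,q)] and [(p,q)]; square roots in the closed field then give a trivialising cochain. *)
Lemma cocycle_asymmetric : is_2cocycle H w -> ~ is_2coboundary H w ->
  W (1, 0) (0, 1) != W (0, 1) (1, 0).
Proof.
move=> [w0 wc] ncob; apply/eqP => sym; apply: ncob.
have W0 x y : W x y != 0 by apply: w0.
have Wc x y z : W x y * W (x + y) z = W y z * W x (y + z).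
  by rewrite -!(kchar_mul k aa bb ab a1 b1 ab1); apply: wc.
pose c := W 0 0.
have W_0r x : W x 0 = c by exact: (@W_0r k _ W).
have W_0l x : W 0 x = c by exact: (@W_0l k _ W).
have c0 : c != 0 by exact: W0.
pose p : V := (1, 0); pose q : V := (0, 1).
have [al alE] := closed_sqrt (W p p * c); have [be beE] := closed_sqrt (W q q * c).
pose u := W p q.
have u0 : u != 0 by exact: W0.
have al0 : al != 0.
  by apply: contraTneq (mulf_neq0 (W0 p p) c0) => al0; rewrite -alE al0 expr0n eqxx.
have be0 : be != 0.
  by apply: contraTneq (mulf_neq0 (W0 q q) c0) => be0; rewrite -beE be0 expr0n eqxx.
have qp : q + p = p + q by exact: addrC.
have ppq : p + (p + q) = q by rewrite addrA V2 add0r.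
have pqq : (p + q) + q = p by rewrite -addrA V2 addr0.
have qpq : q + (p + q) = p by rewrite [p + q]addrC addrA V2 add0r.
have pqp : (p + q) + p = q by rewrite addrAC V2 add0r.
have Wpp : W p p = al ^+ 2 / c by rewrite alE mulfK.
have Wqq : W q q = be ^+ 2 / c by rewrite beE mulfK.
have Wqp : W q p = u by exact: esym.
have Wp_pq : W p (p + q) = al ^+ 2 / u.
  by have := Wc p p q; rewrite V2 W_0l -alE => ->; rewrite mulrC mulKf.
have Wpq_q : W (p + q) q = be ^+ 2 / u.
  by have := Wc p q q; rewrite V2 W_0r -beE => <-; rewrite mulrC mulKf.
have Wq_pq : W q (p + q) = be ^+ 2 / u.
  by have := Wc q q p; rewrite V2 W_0l -beE qp Wqp => ->; rewrite mulrC mulKf.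
have Wpq_p : W (p + q) p = al ^+ 2 / u.
  by have := Wc q p p; rewrite V2 W_0r -alE qp Wqp => <-; rewrite mulrC mulKf.
have Wpq_pq : W (p + q) (p + q) = al ^+ 2 / u * (be ^+ 2 / c) / u.
  have := Wc (p + q) p q; rewrite pqp Wpq_p Wqq -/u => ->.
  by rewrite mulrC mulKf.
(* The diagonal equations at [p] and [q] require F(p)^2 = c W(p,p) and F(q)^2 = c W(q,q); the value
   at [p + q] is forced by W(p,q). *)
pose F x := if x == 0 then c else if x == p then al else if x == q then be else al * be / u.
have F0 : F 0 = c by [].
have Fp : F p = al by [].
have Fq : F q = be by [].
have Fpq : F (p + q) = al * be / u by [].
have FW : forall x y, W x y = F x * F y / F (x + y).
  apply: klein_ind; apply: klein_ind; rewrite -/p -/q ?add0r ?addr0 ?V2 ?ppq ?pqq ?qpq ?pqp ?qp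
    ?W_0l ?W_0r ?Wpp ?Wqq ?Wp_pq ?Wpq_q ?Wq_pq ?Wpq_p ?Wpq_pq ?Wqp -?/u ?F0 ?Fp ?Fq ?Fpq;
  by field; rewrite ?u0 ?c0 ?al0 ?be0.
have Fn0 x : F x != 0.
  by move: x; apply: klein_ind; rewrite ?F0 ?Fp ?Fq ?Fpq ?mulf_neq0 ?invr_eq0.
(* The cochain must be defined on all functions; 1 is a default away from characters. *)
pose f chi := if [pick x | chi == kchar k a b x] is Some x then F x else 1.
have fE x : f (kchar k a b x) = F x.
  rewrite /f; case: pickP => [y /eqP/(kchar_inj k2 aa bb ab a1 b1 ab1)<- //|/(_ x)].
  by rewrite eqxx.
exists f; split=> [chi|chi chi'].
  by move/(is_hcharP aa bb ab a1 b1 ab1) => [x ->]; rewrite fE.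
move=> /(is_hcharP aa bb ab a1 b1 ab1)[x ->] /(is_hcharP aa bb ab a1 b1 ab1)[y ->].
by rewrite (kchar_mul k aa bb ab a1 b1 ab1) !fE FW.
Qed.
End KleinCocycle.

(** * Normal subgroups of the symmetric group *)

Section SymmetricGroup.
Variable n : nat.
Hypothesis n5 : (5 <= n)%N.
Local Notation ALT := ('Alt_('I_n))%g.

(** Simplicity of the alternating group leaves two cases. If [N] meets it trivially, a commutator
    argument makes [N] trivial; otherwise [N] contains it, and its index is 2. *)
Lemma normal_sym (N : {group 'S_n}) : (N <| [set: 'S_n])%g ->
  [\/ N :=: 1%g, N :=: [set: 'S_n] | N :=: [set g | ~~ odd_perm g]].
Proof.
move=> nN; have memJ g h : g \in N -> (g ^ h)%g \in N.
  by move=> gN; rewrite memJ_norm // (subsetP (normal_norm nN)) ?inE.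
have AltE g : (g \in ALT) = ~~ odd_perm g by rewrite Alt_even.
have simpA : simple ALT by apply: simple_Alt5; rewrite card_ord.
have nNA : (N :&: ALT <| ALT)%g.
  by rewrite setIC (normalGI (subsetT _)) //.
have [_ /(_ _ nNA)[NA1|NAA]] := simpleP _ simpA.
- constructor 1; apply/trivgP/subsetP => g gN; apply/set1P.
  apply/permP => x; rewrite perm1; apply/eqP/negPn/negP => gx.
  have [z] : exists z, z \notin [set x; g x].
    apply/existsP; apply: contraT; rewrite negb_exists => /forallP all2.
    have : (#|'I_n| <= #|[set x; g x]|)%N.
      by apply/subset_leq_card/subsetP => z _; have := all2 z; rewrite negbK.
    by rewrite cards2 card_ord; case: (_ != _) => le; have := leq_trans n5 le.
  rewrite !inE negb_or => /andP[zx zgx].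
  pose s := tperm x z.
  (* This commutator of [g] and [s] is even and lies in [N], so it is 1 and [g] commutes with
     [s]. *)
  have : (g^-1 * g ^ s)%g \in N :&: ALT.
    rewrite inE groupM ?groupV ?memJ // AltE odd_permM odd_permV /conjg !odd_permM odd_permV.
    by case: (odd_perm g); case: (odd_perm s).
  rewrite NA1 inE -eq_invg_mul invgK => /eqP gs.
  have sg : (s ^ g)%g = s by apply/conjg_fixP/commgP/commute_sym/commgP/conjg_fixP.
  (* The conjugate transposition sends [g x] to [g z], whereas [s] fixes [g x]; injectivity would
     give [x = z]. *)
  have := congr1 (fun t : 'S_n => t (g x)) sg; rewrite /s tpermJ tpermL tpermD //.
    by move/perm_inj => zx'; rewrite zx' eqxx in zx.
  by rewrite eq_sym.
- have subAN : (ALT \subset N)%g by rewrite -NAA subsetIl.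
  case: (boolP (N \subset 'Alt_('I_n))%g) => [subNA|/subsetPn[g gN gA]].
    by constructor 3; apply/setP=> g; rewrite inE -AltE; apply/idP/idP; apply: subsetP.
  constructor 2; apply/setP => h; rewrite inE; case: (boolP (odd_perm h)) => hodd; last first.
    by rewrite (subsetP subAN) // AltE.
  rewrite -(mulgKV g h) groupM // (subsetP subAN) // AltE odd_permM odd_permV hodd.
  by move: gA; rewrite AltE negbK => ->.
Qed.

End SymmetricGroup.

(** * The Klein subgroup inside the symmetric group *)

Section TranspositionKlein.
Variables (n : nat) (n5 : (5 <= n)%N).
Local Notation V := ('Z_2 * 'Z_2)%type.

Definition pt i (lti : (i < 5)%N) : 'I_n := Ordinal (leq_trans lti n5).
Local Notation o0 := (@pt 0 isT).
Local Notation o1 := (@pt 1 isT).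
Local Notation o2 := (@pt 2 isT).
Local Notation o3 := (@pt 3 isT).
Local Notation o4 := (@pt 4 isT).
Local Notation a := (transp n 0 1).
Local Notation b := (transp n 2 3).

Lemma pt_eq i j (lti : (i < 5)%N) (ltj : (j < 5)%N) : (pt lti == pt ltj) = (i == j).
Proof. by []. Qed.

Lemma transpE i j (lti : (i < 5)%N) (ltj : (j < 5)%N) : transp n i j = tperm (pt lti) (pt ltj).
Proof.
rewrite /transp (insubT (fun m => m < n)%N (leq_trans lti n5)).
by rewrite (insubT (fun m => m < n)%N (leq_trans ltj n5)).
Qed.

Lemma transp01E : a = tperm o0 o1. Proof. exact: transpE. Qed.
Lemma transp23E : b = tperm o2 o3. Proof. exact: transpE. Qed.

Lemma transp01_sqr : (a * a)%g = 1%g. Proof. by rewrite transp01E tperm2. Qed.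
Lemma transp23_sqr : (b * b)%g = 1%g. Proof. by rewrite transp23E tperm2. Qed.
Lemma transp_comm : commute a b.
Proof.
apply/commgP/conjg_fixP; rewrite transp01E transp23E tpermJ !tpermD ?pt_eq //.
Qed.

Lemma tperm_moves (x y : 'I_n) (s : 'S_n) : x != y -> s x = x -> tperm x y != s.
Proof. by move=> xy sx; apply: contraNneq xy => ts; rewrite -[x in x == _]sx -ts tpermL. Qed.

Lemma transp01_neq1 : a != 1%g. Proof. by rewrite transp01E tperm_moves ?perm1 ?pt_eq. Qed.
Lemma transp23_neq1 : b != 1%g. Proof. by rewrite transp23E tperm_moves ?perm1 ?pt_eq. Qed.
Lemma transp01_neq23 : a != b.
Proof. by rewrite transp01E transp23E tperm_moves ?tpermD ?pt_eq. Qed.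

Variable k : fieldType.

Definition sgn (g : 'S_n) : k := (-1) ^+ odd_perm g.

Lemma sgnM g h : sgn (g * h)%g = sgn g * sgn h.
Proof. by rewrite /sgn odd_permM signr_addb. Qed.

(** Both generators are odd, so the sign restricts to the character [(1, 1)]. *)
Lemma sgn_klein z : sgn (klein a b z) = pairing k (1, 1) z.
Proof.
have sX (g : 'S_n) (i : 'Z_2) : sgn g = -1 -> sgn (g ^+ i)%g = sg k i.
  move=> sg; move: i; apply: Z2P; rewrite ?expg0 ?expg1 ?sg /sgn ?odd_perm1 //.
by rewrite /klein sgnM /pairing !mul1r !sX // /sgn ?transp01E ?transp23E odd_tperm pt_eq.
Qed.

(* [mix] conjugates <(01),(23)> to <(02),(14)>, which meets it trivially. *)
Definition mix : 'S_n := (tperm o1 o2 * tperm o3 o4)%g.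

(** H preserves the points 0 and 1 as a set. Since [mix] carries 0 and 2 to 0 and 1, but 1 and 3 to
    2 and 4, an element [z] satisfying the relation can move neither 0 nor 2. *)
Lemma klein_mix z z' : (klein a b z * mix * klein a b z')%g = mix -> z = 0 /\ z' = 0.
Proof.
move=> kmk; have km : (klein a b z * mix = mix * klein a b z')%g.
  have kk : (klein a b z' * klein a b z' = 1)%g by rewrite -(kleinD transp01_sqr transp23_sqr transp_comm) V2 /klein mulg1.
  by rewrite -{2}kmk -[RHS]mulgA kk mulg1.
have evalE x : mix (klein a b z x) = klein a b z' (mix x) by rewrite -!permM km.
have low y x : (x == o0) || (x == o1) -> (klein a b y x == o0) || (klein a b y x == o1).
  case: y => i j; rewrite /klein /=.
  by move: i j; apply: Z2P; apply: Z2P; case/orP=> /eqP->;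
    rewrite ?expg0 ?expg1 ?mul1g ?mulg1 ?permM ?perm1 ?transp01E ?transp23E ?(tpermL, tpermR) ?tpermD ?pt_eq.
have mix0 : mix o0 = o0 by rewrite permM !tpermD ?pt_eq.
have mix1 : mix o1 = o2 by rewrite permM tpermL tpermD ?pt_eq.
have mix2 : mix o2 = o1 by rewrite permM tpermR tpermD ?pt_eq.
have mix3 : mix o3 = o4 by rewrite permM [tperm o1 o2 _]tpermD ?pt_eq // tpermL.
have z0 : z = 0.
  have low0 : (klein a b z' o0 == o0) || (klein a b z' o0 == o1) by rewrite low ?pt_eq.
  have low1 : (klein a b z' o1 == o0) || (klein a b z' o1 == o1) by rewrite low ?pt_eq.
  have := evalE o0; have := evalE o2; rewrite mix0 mix2 => e2 e0; move: low0 low1; rewrite -e0 -e2.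
  case: z {evalE kmk km e0 e2} => i j; move: i j; apply: Z2P; apply: Z2P => //;
    rewrite ?[klein a b _ _]permM /= ?expg0 ?expg1 ?perm1 ?transp01E ?transp23E ?tpermL.
- by rewrite mix3 !pt_eq => _.
  - by rewrite mix1 !pt_eq.
  by rewrite [tperm o2 o3 o1]tpermD ?pt_eq // mix1 !pt_eq.
split=> //; apply: (klein_inj transp01_sqr transp23_sqr transp_comm transp01_neq1 transp23_neq1 transp01_neq23).
by apply: (mulgI mix); rewrite -km z0 /klein !mul1g mulg1.
Qed.

End TranspositionKlein.

Theorem theorem3p5 (k : closedFieldType) (hchar : [pchar k] =i pred0)
  (n : nat) (hn : (5 <= n)%N)
  (s : seq (galg 'S_n k)) (hs : enumerates_chars (H1234 n) s)
  (w : galg 'S_n k -> galg 'S_n k -> k)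
  (hw : is_2cocycle (H1234 n) w)
  (hnontriv : ~ is_2coboundary (H1234 n) w) :
  twisted_simple (twistJ (H1234 n) s w).
Proof.
have k2 : 2 != 0 :> k by have /pcharf0P-> := hchar.
pose a := transp n 0 1; pose b := transp n 2 3.
have [aa' bb' ab'] := And3 (transp01_sqr hn) (transp23_sqr hn) (transp_comm hn).
have [a1' b1' ab1'] := And3 (transp01_neq1 hn) (transp23_neq1 hn) (transp01_neq23 hn).
rewrite (twistJ_kchar k2 aa' bb' ab' a1' b1' ab1' _ hs).
have Wasym := cocycle_asymmetric k2 aa' bb' ab' a1' b1' ab1' hw hnontriv.
have [w0 wc] := hw.
have kH x : is_hchar (H1234 n) (kchar k a b x).
  by apply/(is_hcharP aa' bb' ab' a1' b1' ab1'); exists x.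
have W0 x y : w (kchar k a b x) (kchar k a b y) != 0 by apply: w0.
have Wc x y z : w (kchar k a b x) (kchar k a b y) * w (kchar k a b (x + y)) (kchar k a b z)
    = w (kchar k a b y) (kchar k a b z) * w (kchar k a b x) (kchar k a b (y + z)).
  by rewrite -!(kchar_mul k aa' bb' ab' a1' b1' ab1'); apply: wc.
(* With t = (1,1), the character of the sign, and p = (1,0), one has p + t = (0,1), so the required
   asymmetry is exactly [Wasym]. *)
apply: (@twisted_simple_J k _ _ (klein a b) (pairing k) _ V2 (cardV_neq0 k2) (kleinD aa' bb' ab')
  (pairing0l k) (pairing0r k) (pairingDl k) (pairingDr k) (sum_pairing k) (sum_pairingr k) W0 Wc
  (sgn k) (1, 1) (1, 0) (mix hn)) => //.
- exact: sgnM.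
- exact: (sgn_klein hn).
- by move=> g; rewrite /sgn; case: odd_perm; [right; rewrite expr1 | left].
- exists (1, 0); rewrite (sgn_klein hn) /pairing /sg /= expr1 expr0 mulr1.
  exact: neg1_neq1.
- have -> : (1, 0) + (1, 1) = (0, 1) :> 'Z_2 * 'Z_2 by congr pair; apply: val_inj.
  by rewrite eq_sym.
- exact: klein_mix.
move=> N /(normal_sym hn)[N1|NG|NA]; [exact: Or31|exact: Or32|apply: Or33].
rewrite NA; apply/setP => g; rewrite !inE /sgn; case: odd_perm; rewrite /= ?expr1 ?eqxx //.
by rewrite (negPf (neg1_neq1 k2)).
Qed.
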